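(* Every digraph with minimum out-degree at least $3$ contains a subdivision of every orientation of $K_4$ with no sink.
   Context: All digraphs are finite, nonempty and simple: no loops and no two distinct arcs with the same tail and the same head (two arcs with opposite directions between the same pair of vertices are allowed). A sink is a vertex with out-degree 0. An orientation of $K_4$ is obtained by replacing each edge of $K_4$ by exactly one of its two possible arcs. A digraph contains a subdivision of $\vec F$ if it has a subdigraph isomorphic to a digraph obtained from $\vec F$ by replacing each arc $(u,v)$ by a directed path from $u$ to $v$ of length at least one, these paths being internally disjoint from each other and from $V(\vec F)$. *)

(* Defs.v *)
From mathcomp Require Import all_boot.
Set Implicit Arguments.
Unset Strict Implicit.
Unset Printing Implicit Defensive.

(* Arcs form a relation, so there are no parallel arcs; opposite arcs [arc u v]
   and [arc v u] may coexist. *)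
Record digraph := Digraph {
  vertex :> finType;
  arc : rel vertex;
  arc_irrefl : irreflexive arc;
  vertex_gt0 : 0 < #|vertex|
}.
Arguments arc {d} u v : rename.

Definition outdeg (D : digraph) (u : D) : nat := #|[set v : D | arc u v]|.

Definition min_outdeg_geq (D : digraph) (k : nat) : Prop :=
  forall u : D, k <= outdeg u.

Definition sink (D : digraph) (u : D) : Prop := outdeg u = 0.

Definition K4_orientation (F : digraph) : Prop :=
  #|F| = 4 /\ forall u v : F, u != v -> arc u v (+) arc v u.

(* [phi] places the vertices of F in S, and [p u v] lists in order the internal
   vertices of the path replacing the arc (u, v); it is irrelevant when (u, v)
   is not an arc. The last two fields say that S has no vertex and no arc
   besides those of the branch vertices and the paths. *)
Record subdivision_by (F S : digraph) (phi : F -> S) (p : F -> F -> seq S)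
    : Prop := SubdivisionBy {
  sd_branch_inj : injective phi;
  sd_path : forall u v : F, arc u v ->
    path arc (phi u) (rcons (p u v) (phi v));
  sd_path_uniq : forall u v : F, arc u v ->
    uniq (phi u :: rcons (p u v) (phi v));
  sd_path_branch : forall u v w : F, arc u v -> phi w \notin p u v;
  sd_path_disjoint : forall u v u' v' : F, arc u v -> arc u' v' ->
    (u, v) != (u', v') -> ~~ has [in p u v] (p u' v');
  sd_vertex : forall x : S,
    (exists u : F, x = phi u) \/ (exists u v : F, arc u v /\ x \in p u v);
  sd_arc : forall x y : S, arc x y -> exists u v : F,
    arc u v /\ infix [:: x; y] (phi u :: rcons (p u v) (phi v))
}.

Definition is_subdivision (F S : digraph) : Prop :=
  exists (phi : F -> S) (p : F -> F -> seq S), subdivision_by phi p.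

(* S is isomorphic to a (not necessarily induced) subdigraph of D. *)
Definition isomorphic_to_subdigraph (S D : digraph) : Prop :=
  exists f : S -> D, injective f /\ {homo f : x y / arc x y}.

Definition contains_subdivision (D F : digraph) : Prop :=
  exists S : digraph, is_subdivision F S /\ isomorphic_to_subdigraph S D.

(* Main.v *)
Require Import Defs.
From mathcomp Require Import all_boot zify.
(* [path] also exports a constant named [arc]. *)
Import Defs.
Set Implicit Arguments.
Unset Strict Implicit.
Unset Printing Implicit Defensive.

(** The out-degree condition is weakened for the sake of induction on |D|: one
    vertex r may have any positive out-degree. Then D may be taken strong.

    A K4 orientation without sink is either a source dominating a directed
    triangle or the strong tournament. By Menger's theorem both are obtained
    from a cycle C, an arc from C to a vertex s off C, and the fact that no two
    vertices separate s from C: three leaves of a fan from s to C give the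
    first, the arc and two leaves off its tail give the second.

    Let R be inclusion-minimal among the nonempty sets avoiding r with at most
    two out-neighbours. If there is only one out-neighbour z, everything outside
    R and z is contracted to an arc from z back to R. Otherwise let z1, z2 be the
    out-neighbours. If some vertex outside R is reachable outside R from both,
    there is a cycle C through one of them that meets R, does not contain R, and
    is reached from the other one outside R; minimality of R then gives s.
    Otherwise the sets W1, W2 reachable from z1, z2 outside R are disjoint, and
    r is not in W1, say. If there is a fan of three paths from z1 to R, replacing
    W1 by three arcs and W2 by one yields a smaller digraph whose exceptional
    vertex is z2. If not, W1 contains a minimal set R2 of the same kind, whose
    out-neighbours y1, y2 have disjoint reachable sets outside R2; R and W2 lie
    in that of y2, so R2 together with that of y1 has y2 as its only
    out-neighbour. *)

(** * Menger's theorem *)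

Section Menger.
Variable V : finType.
Implicit Types (e : rel V) (A B X : {set V}).

(** Only the heads of arcs are tested: a walk may start inside [X], but all its later vertices lie
    outside. *)
Definition avoid e X := [rel x y | e x y && (y \notin X)].

Lemma path_avoid e X x p :
  path (avoid e X) x p = path e x p && ~~ has [in X] p.
Proof.
elim: p x => //= y p IH x; rewrite IH negb_or.
by case: (e x y); case: (path e y p); case: (y \in X).
Qed.

Lemma split_walk (x v : V) p : v \in x :: p ->
  exists p1 p2, p = p1 ++ p2 /\ last x p1 = v.
Proof. by case/splitPl => p1 p2; exists p1, p2. Qed.

(** Starts in [X] are removed explicitly because [avoid] does not test them. One-vertex paths count,
    so a separator contains [A :&: B]. *)
Definition separates e A B X :=
  [forall x in A :\: X, forall y in B, ~~ connect (avoid e X) x y].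

Lemma separatesP e A B X :
  reflect (forall x p, x \in A -> path e x p -> last x p \in B ->
             has [in X] (x :: p))
          (separates e A B X).
Proof.
apply: (iffP forall_inP) => [sep x p xA pe pB|sep x].
  apply: contraT; rewrite /= negb_or => /andP [xX pX].
  have xAX : x \in A :\: X by rewrite inE xX.
  have /forall_inP/(_ _ pB)/connectP := sep _ xAX; case.
  by exists p => //; rewrite path_avoid pe.
rewrite inE => /andP [xX xA]; apply/forall_inP => y yB.
apply/connectP => - [p]; rewrite path_avoid => /andP [pe pX] yE.
by have := sep x p xA pe; rewrite -yE /= (negbTE xX) (negbTE pX) => /(_ yB).
Qed.

Definition linkage e A B k (f : 'I_k -> V * seq V) :=
  (forall i, [/\ (f i).1 \in A, path e (f i).1 (f i).2,
     last (f i).1 (f i).2 \in B & uniq ((f i).1 :: (f i).2)]) /\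
  (forall i j x, x \in (f i).1 :: (f i).2 -> x \in (f j).1 :: (f j).2 -> i = j).

Lemma inj_card_onto k (h : 'I_k -> V) X :
  injective h -> (forall i, h i \in X) -> #|X| = k ->
  forall t, t \in X -> exists i, h i = t.
Proof.
move=> h_inj hX cX t tX.
have /eqP eqX : [set h i | i : 'I_k] == X.
  rewrite eqEcard card_imset // card_ord cX leqnn andbT.
  by apply/subsetP => _ /imsetP [i _ ->].
by move: tX; rewrite -eqX => /imsetP [i _ ->]; exists i.
Qed.

(** Shortcutting a walk keeps its ends and adds no vertex, so disjoint walks suffice. *)
Lemma linkage_shorten e A B k (f : 'I_k -> V * seq V) :
  (forall i, [/\ (f i).1 \in A, path e (f i).1 (f i).2
     & last (f i).1 (f i).2 \in B]) ->
  (forall i j x, x \in (f i).1 :: (f i).2 -> x \in (f j).1 :: (f j).2 -> i = j) ->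
  exists g : 'I_k -> V * seq V, linkage e A B g.
Proof.
move=> fP dis; exists (fun i => ((f i).1, shorten (f i).1 (f i).2)).
have sub i : {subset (f i).1 :: shorten (f i).1 (f i).2 <= (f i).1 :: (f i).2}.
  have [_ pe _] := fP i; case/shortenP: pe => p' _ _ sp x.
  by rewrite !inE => /orP [->//|/sp ->]; rewrite orbT.
split=> [i|i j x /sub xi /sub xj] /=; last exact: dis xi xj.
by have [fA pe fB] := fP i; move: fB; case/shortenP: pe.
Qed.

Definition del_arc e x y := [rel a b | e a b && ((a, b) != (x, y))].

(** The walk is stopped at [x] before it can use the deleted arc. *)
Lemma del_arc_prefix e x y a p : path e a p ->
  path (del_arc e x y) a p \/
  exists q, [/\ path (del_arc e x y) a q, last a q = x &
     {subset a :: q <= a :: p}].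
Proof.
elim: p a => [|b p IH] a /=; first by left.
case/andP=> eab /IH; have [->|ax] := eqVneq a x.
  by move=> _; right; exists [::]; split=> // z; rewrite !inE => ->.
have eab' : e a b && ((a, b) != (x, y)) by rewrite eab xpair_eqE (negbTE ax).
case=> [pe|[q [pe lq sq]]]; first by left; rewrite eab'.
right; exists (b :: q); split=> //=; first by rewrite eab'.
by move=> z; rewrite inE => /orP [/eqP->|/sq zp]; rewrite inE ?eqxx // zp orbT.
Qed.

(** The walk is resumed at [y] after its last use of the deleted arc. *)
Lemma del_arc_suffix e x y a p : path e a p ->
  path (del_arc e x y) a p \/
  exists q, [/\ path (del_arc e x y) y q, last y q = last a p &
     {subset y :: q <= a :: p}].
Proof.
elim: p a => [|b p IH] a /=; first by left.
case/andP=> eab /IH [pe|[q [pe lq sq]]]; last first.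
  by right; exists q; split=> // z /sq zp; rewrite inE zp orbT.
have [[aE bE]|ne] := eqVneq (a, b) (x, y); last by left; rewrite eab pe.
subst a b; right; exists p; split=> // z zp.
by rewrite inE zp orbT.
Qed.

(* Goering's proof, by induction on the number of arcs. *)
Theorem menger e A B k :
  (forall X, separates e A B X -> k <= #|X|) ->
  exists f : 'I_k -> V * seq V, linkage e A B f.
Proof.
have [n] := ubnP #|[set a : V * V | e a.1 a.2]|.
elim: n e A B => // n IH e A B le_n sep_ge.
case: (pickP (fun a : V * V => e a.1 a.2)) => [[x y] /= exy|noarc]; last first.
  (* Without arcs [A :&: B] is itself a separator, and its vertices serve as one-vertex paths. *)
  have kAB : k <= #|A :&: B|.
    apply/sep_ge/separatesP => a [|b p] aA /=; first by rewrite inE aA => _ ->.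
    by have /= -> := noarc (a, b).
  pose h (i : 'I_k) : V := enum_val (widen_ord kAB i).
  have hAB i : h i \in A :&: B by apply: enum_valP.
  exists (fun i => (h i, [::])); split=> [i|i j z] /=.
    by have := hAB i; rewrite inE => /andP [].
  rewrite !inE => /eqP -> /eqP /enum_val_inj /(congr1 val) /= ji.
  exact/val_inj.
pose e' := del_arc e x y.
have e'e : subrel e' e by move=> a b /andP [].
have lt_e' : #|[set a : V * V | e' a.1 a.2]| < n.
  rewrite -ltnS; apply: leq_trans le_n; apply: proper_card; apply/properP; split.
    by apply/subsetP => a; rewrite !inE => /andP [].
  by exists (x, y); rewrite ?inE //= eqxx andbF.
case: (boolP [exists X : {set V}, (#|X| < k) && separates e' A B X]); last first.
  move/existsPn => noX; have [|f [fP dis]] := IH e' A B lt_e'.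
    by move=> X Xsep; rewrite leqNgt; apply: contraL (noX X); rewrite Xsep => ->.
  exists f; split=> // i; have [? pe ? ?] := fP i; split=> //.
  exact: sub_path pe.
case/existsP => S /andP [S_lt /separatesP Ssep].
(* A path from [A] to [B] that misses [S] must use the deleted arc and so meets both of its ends.
   Hence [S] plus either end separates in [e], which forces [S] to have exactly [k - 1] vertices. *)
have sepSx : separates e A B (x |: S).
  apply/separatesP => a p aA pe pB; case: (del_arc_prefix x y pe) => [pe'|].
    have /hasP [z zp zS] := Ssep _ _ aA pe' pB.
    by apply/hasP; exists z => //; rewrite inE /= (zS : z \in S) orbT.
  case=> q [_ lq sq]; apply/hasP; exists x; last by rewrite /= inE set11.
  by apply: sq; rewrite -lq mem_last.
have sepSy : separates e A B (y |: S).
  apply/separatesP => a p aA pe pB; case: (del_arc_suffix x y pe) => [pe'|].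
    have /hasP [z zp zS] := Ssep _ _ aA pe' pB.
    by apply/hasP; exists z => //; rewrite inE /= (zS : z \in S) orbT.
  case=> q [_ lq sq]; apply/hasP; exists y; last by rewrite /= inE set11.
  by apply: sq; rewrite mem_head.
have cardS z : separates e A B (z |: S) -> z \notin S /\ #|z |: S| = k.
  move/sep_ge; rewrite cardsU1; case: (z \in S) => /= le_k; last first.
    by split=> //; apply/eqP; rewrite eqn_leq le_k andbT.
  by rewrite add0n leqNgt S_lt in le_k.
have [xS cSx] := cardS _ sepSx; have [yS cSy] := cardS _ sepSy.
(* A set separating [A] from [x |: S] in [e'] separates [A] from [B] in [e], because every path from
   [A] to [B] in [e] has an initial segment in [e'] that reaches [x |: S]. The other side is
   symmetric. *)
have [|f [fP fdis]] := IH e' A (x |: S) lt_e'.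
  move=> X /separatesP Xsep; apply/sep_ge/separatesP => a p aA pe pB.
  have lift q : path e' a q -> last a q \in x |: S -> {subset a :: q <= a :: p} ->
      has [in X] (a :: p).
    by move=> qe qS sq; have /hasP [z /sq zp zX] := Xsep _ _ aA qe qS; apply/hasP; exists z.
  case: (del_arc_prefix x y pe) => [pe'|[q [qe lq sq]]]; last first.
    by apply: (lift q) => //; rewrite lq setU11.
  have /hasP [z zp zS] := Ssep _ _ aA pe' pB.
  case/splitPl: zp pe' {pB lift pe} (lift) => p1 p2 zE; rewrite cat_path => /andP [pe1 _] lift.
  by apply: (lift p1) => //; rewrite ?zE ?inE ?(zS : z \in S) ?orbT // => t;
    rewrite !inE mem_cat => /orP [->//|->]; rewrite orbT.
have [|g [gP gdis]] := IH e' (y |: S) B lt_e'.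
  move=> X /separatesP Xsep; apply/sep_ge/separatesP => a p aA pe pB.
  have lift b q : b \in y |: S -> path e' b q -> last b q \in B ->
      {subset b :: q <= a :: p} -> has [in X] (a :: p).
    by move=> bS qe qB sq; have /hasP [z /sq zp zX] := Xsep _ _ bS qe qB; apply/hasP; exists z.
  case: (del_arc_suffix x y pe) => [pe'|[q [qe lq sq]]]; last first.
    by apply: (lift y q) => //; rewrite ?lq ?setU11.
  have /hasP [z zp zS] := Ssep _ _ aA pe' pB.
  case/splitPl: zp pe' pB {pe} lift => p1 p2 zE;
    rewrite cat_path last_cat zE => /andP [_ pe2] pB lift.
  apply: (lift z p2) => //; first by rewrite !inE (zS : z \in S) orbT.
  by move=> t; rewrite inE -cat_cons mem_cat => /orP [/eqP->|->];
    rewrite ?orbT // -zE mem_last.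
pose lf i := last (f i).1 (f i).2.
have lf_inj : injective lf.
  by move=> i j ij; apply: (fdis i j (lf i)); rewrite ?mem_last // [lf i]ij mem_last.
have lfS i : lf i \in x |: S by have [] := fP i.
have hg_inj : injective (fun i => (g i).1).
  by move=> i j ij; apply: (gdis i j (g i).1); rewrite ?mem_head // ij mem_head.
have hgS i : (g i).1 \in y |: S by have [] := gP i.
have f_onto := inj_card_onto lf_inj lfS cSx.
have g_onto := inj_card_onto hg_inj hgS cSy.
(* The bijection along which the two linkages are glued: [x] is sent to [y] across the deleted arc,
   and [S] is fixed. *)
pose sg t := if t == x then y else t.
have sgS t : t \in x |: S -> sg t \in y |: S.
  by rewrite /sg !inE; have [->|_ /= ->] := eqVneq t x; rewrite ?eqxx ?orbT.
have sg_inj t u : t \in x |: S -> u \in x |: S -> sg t = sg u -> t = u.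
  rewrite /sg !inE; have [->|tx] := eqVneq t x; have [->|ux] //= := eqVneq u x.
    by move=> _ uS yu; rewrite yu uS in yS.
  by move=> tS _ ty; rewrite -ty tS in yS.
have jP i : exists j, (g j).1 == sg (lf i).
  by have [j <-] := g_onto _ (sgS _ (lfS i)); exists j.
pose j i := xchoose (jP i).
have jE i : (g (j i)).1 = sg (lf i) by apply/eqP/(xchooseP (jP i)).
have j_inj : injective j.
  by move=> i i' jj; apply/lf_inj/sg_inj; rewrite ?lfS // -!jE jj.
(* Since S separates A from B in e', the two linkages can only meet in S, at
   the endpoints where they are glued. *)
have meet i i' v : v \in (f i).1 :: (f i).2 -> v \in (g i').1 :: (g i').2 ->
    v = lf i /\ v = (g i').1.
  move=> vf vg; have [fA fe fS fu] := fP i; have [gS ge gB gu] := gP i'.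
  have fin z : z \in (f i).1 :: (f i).2 -> z \in S -> z = lf i.
    move=> zf zS; have [|i2 zE] := f_onto z; first by rewrite inE zS orbT.
    by rewrite -zE; congr lf; apply: (fdis _ _ z) => //; rewrite -zE mem_last.
  have gin z : z \in (g i').1 :: (g i').2 -> z \in S -> z = (g i').1.
    move=> zf zS; have [|i2 zE] := g_onto z; first by rewrite inE zS orbT.
    by rewrite -zE; congr ((g _).1); apply: (gdis _ _ z) => //; rewrite -zE mem_head.
  suff vS : v \in S by split; [apply: fin | apply: gin].
  (* Switching paths at [v] gives a walk from [A] to [B] in [e'], which meets [S]. It cannot do so
     after [v], where the first vertex of the second path would be repeated. Up to [v], it can only
     do so at the last vertex of the first path, which is then [v]. *)
  have [p1 [p2 [fpE vE]]] := split_walk vf; have [q1 [q2 [gpE vE']]] := split_walk vg.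
  move: fe ge gB; rewrite fpE gpE !cat_path last_cat vE vE'.
  move=> /andP [fe1 fe2] /andP [ge1 ge2] gB.
  have /hasP [z zp /= zS] : has [in S] ((f i).1 :: p1 ++ q2).
    by apply: Ssep => //; rewrite ?cat_path ?last_cat vE ?fe1.
  move: zp; rewrite -cat_cons mem_cat => /orP [zp|zq]; last first.
    have zE : z = (g i').1 by apply: gin; rewrite // gpE inE mem_cat zq !orbT.
    by move: gu; rewrite -zE gpE /= mem_cat zq orbT.
  have zE : z = lf i by apply: fin; rewrite // fpE -cat_cons mem_cat zp.
  suff p2E : p2 = [::].
    by have := zE; rewrite /lf fpE p2E cats0 vE => <-.
  rewrite fpE in fu; case: p2 fu fpE {fe2 fin} => // c p2;
    rewrite -cat_cons cat_uniq => /and3P [_ /hasPn nofp _] fpE.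
  by have := nofp z; rewrite /= zp => H; apply/eqP; apply: contraT => _; apply: H;
    rewrite zE /lf fpE last_cat /= mem_last.
(* If the first path ends at [x], the second is appended with its head [y]; otherwise that head
   equals the end of the first path and is dropped. *)
apply: (@linkage_shorten _ _ _ _ (fun i => ((f i).1, (f i).2 ++
   (if lf i == x then (g (j i)).1 :: (g (j i)).2 else (g (j i)).2)))).
  move=> i /=; have [fA fe fS fu] := fP i; have [gS ge gB gu] := gP (j i).
  rewrite cat_path last_cat -/(lf i) (sub_path e'e fe) /=.
  have := jE i; rewrite /sg; case: eqP => [lx|_] gE /=.
    by rewrite lx gE exy -gE (sub_path e'e ge).
  by rewrite -gE (sub_path e'e ge).
move=> i i' v.
have mem_glue i0 : v \in (f i0).1 :: (f i0).2 ++
   (if lf i0 == x then (g (j i0)).1 :: (g (j i0)).2 else (g (j i0)).2) ->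
   (v \in (f i0).1 :: (f i0).2) || (v \in (g (j i0)).1 :: (g (j i0)).2).
  rewrite -cat_cons mem_cat; case: ifP => // _ /orP [->//|vg].
  by rewrite [in X in _ || X]inE vg !orbT.
have clash i1 i2 : v \in (f i1).1 :: (f i1).2 ->
   v \in (g (j i2)).1 :: (g (j i2)).2 -> i1 = i2.
  move=> v1 v2; have [v1E v2E] := meet _ _ _ v1 v2; apply: lf_inj.
  have : lf i1 = sg (lf i2) by rewrite -jE -v1E.
  rewrite /sg; case: eqP => // l2 l1; have := lfS i1; rewrite l1 !inE (negbTE yS) orbF.
  by move=> /eqP ->; rewrite l2.
move=> /= /mem_glue/orP [vi|vi] /mem_glue/orP [vi'|vi'].
- exact: fdis vi vi'.
- exact: clash.
- by apply/esym/clash.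
- exact/j_inj/(gdis _ _ v).
Qed.

Lemma connect_uniqP e x y :
  connect e x y -> exists p, [/\ path e x p, last x p = y & uniq (x :: p)].
Proof.
case/connectP => p pe ->; case/shortenP: pe => q qe qu _.
by exists q.
Qed.

(** Menger's theorem is applied from the out-neighbours of [s] to [B] with the arcs into [s]
    removed; each path is then cut at its first vertex in [B]. *)
Lemma fan e B s k : s \notin B ->
  (forall X, #|X| < k -> s \notin X ->
     exists2 y, y \in B & connect (avoid e X) s y) ->
  exists (p : 'I_k -> seq V) (y : 'I_k -> V),
    (forall i, [/\ path e s (rcons (p i) (y i)), uniq (s :: rcons (p i) (y i)),
       y i \in B & ~~ has [in B] (p i)]) /\
    (forall i j x, x \in rcons (p i) (y i) -> x \in rcons (p j) (y j) -> i = j).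
Proof.
move=> sB reach.
have [|f [fP dis]] := @menger (avoid e [set s]) [set x | e s x & x != s] B k.
  move=> X /separatesP sep; rewrite leqNgt; apply/negP => ltX.
  have [||y yB /connect_uniqP [p [pe pl pu]]] := reach (X :\ s).
  - by apply: leq_ltn_trans ltX; rewrite subset_leq_card ?subD1set.
  - by rewrite !inE eqxx.
  move: pe; rewrite path_avoid => /andP [pe pX].
  case: p pe pX pl pu => [|x p] /=; first by move=> _ _ sE; rewrite sE yB in sB.
  case/andP=> sx pe pX pl /andP [sp pu].
  have /hasP [z zp zX] : has [in X] (x :: p).
    apply: sep; rewrite ?pl // ?inE ?sx.
      by apply: contraNneq sp => <-; rewrite mem_head.
    rewrite path_avoid pe; apply/hasPn => z zp; rewrite inE.
    by apply: contraNneq sp => <-; rewrite inE zp orbT.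
  move/negP: pX; apply; rewrite -[_ || _]/(has [in X :\ s] (x :: p)).
  apply/hasP; exists z => //; rewrite !inE (zX : z \in X) andbT.
  by apply: contraNneq sp => <-.
have cut i : exists py, [/\ path e s (rcons py.1 py.2), uniq (s :: rcons py.1 py.2),
    py.2 \in B, ~~ has [in B] py.1 & {subset rcons py.1 py.2 <= (f i).1 :: (f i).2}].
  have [] := fP i; rewrite inE path_avoid => /andP [sf fs] /andP [fe fns] fB fu.
  have hasB : has [in B] ((f i).1 :: (f i).2) by apply/hasP; exists (last (f i).1 (f i).2);
    rewrite ?mem_last.
  have fe' : path e s ((f i).1 :: (f i).2) by rewrite /= sf.
  have fu' : uniq (s :: (f i).1 :: (f i).2).
    rewrite cons_uniq fu andbT inE negb_or eq_sym fs.
    by apply: contra fns => sf2; apply/hasP; exists s; rewrite ?inE.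
  case: (split_find hasB) fe' fu' => y p q yB pB; rewrite cat_path -cat_cons cat_uniq.
  case/andP => pe _ /and3P [pu _ _]; exists (p, y); split=> //.
  by move=> z zp; rewrite mem_cat zp.
have [h hP] := fin_all_exists cut.
exists (fun i => (h i).1), (fun i => (h i).2); split=> [i|i j x xi xj];
  first by have [] := hP i.
have [_ _ _ _ si] := hP i; have [_ _ _ _ sj] := hP j.
by apply: (dis i j x); [apply: si | apply: sj].
Qed.
End Menger.

(** * Topological minors *)

Section SubDigraph.
Variables (D : digraph) (S : {set D}) (e : rel D).
Hypotheses (e_irr : irreflexive e) (S_neq0 : S != set0).

Lemma sub_digraph_irr : irreflexive (fun a b : {x | x \in S} => e (val a) (val b)).
Proof. by move=> a; apply: e_irr. Qed.

Lemma sub_digraph_gt0 : 0 < #|{: {x | x \in S}}|.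
Proof.
have [x xS] := set0Pn _ S_neq0.
by apply/card_gt0P; exists (Sub x xS).
Qed.

(** The relation [e] need not be contained in [arc]: in the reductions its arcs stand for paths of
    [D]. *)
Definition sub_digraph : digraph := Digraph sub_digraph_irr sub_digraph_gt0.

Lemma card_sub_digraph : #|sub_digraph| = #|S|.
Proof. by rewrite card_sig; apply: eq_card => x; rewrite !inE. Qed.

Lemma outdeg_sub_digraph (a : sub_digraph) :
  outdeg a = #|[set y in S | e (val a) y]|.
Proof.
rewrite /outdeg -(card_imset _ val_inj); apply: eq_card => y.
apply/imsetP/idP => [[b + ->]|]; rewrite !inE; first by move=> eab; rewrite (valP b).
by case/andP=> yS eay; exists (Sub y yS); rewrite ?inE ?SubK.
Qed.

End SubDigraph.

(** A subdivision read directly inside [D]: the conditions of [subdivision_by] except that vertices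
    and arcs be exhausted, which [top_minor_contains] restores. This form composes easily. *)
Record top_minor_by (F D : digraph) (phi : F -> D) (p : F -> F -> seq D) : Prop :=
  TopMinorBy {
  tm_inj : injective phi;
  tm_path : forall u v : F, arc u v ->
    path arc (phi u) (rcons (p u v) (phi v));
  tm_uniq : forall u v : F, arc u v ->
    uniq (phi u :: rcons (p u v) (phi v));
  tm_branch : forall u v w : F, arc u v -> phi w \notin p u v;
  tm_disjoint : forall u v u' v' : F, arc u v -> arc u' v' ->
    (u, v) != (u', v') -> ~~ has [in p u v] (p u' v')
}.

Definition top_minor (F D : digraph) : Prop :=
  exists (phi : F -> D) (p : F -> F -> seq D), top_minor_by phi p.

Lemma path_infix (T : eqType) (e : rel T) a s :
  (forall x y, infix [:: x; y] (a :: s) -> e x y) -> path e a s.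
Proof.
elim: s a => //= b s IH a sub; apply/andP; split.
  by apply: sub; rewrite /= !eqxx prefix0s.
by apply: IH => x y sxy; apply: sub; rewrite sxy orbT.
Qed.

Lemma infix_path (T : eqType) (e : rel T) x y a s :
  infix [:: x; y] (a :: s) -> path e a s -> e x y.
Proof.
elim: s a => [|b s IH] a; first by case/infixP => [[|? [|? ?]] [? []]].
rewrite infix_consl => /orP [|/IH inf]; last by move=> /andP [].
by rewrite /= => /andP [/eqP -> /andP [/eqP -> _]] /andP [].
Qed.

(** The subdivision consists of the branch vertices, the path vertices, and only those arcs that the
    paths traverse. *)
Lemma top_minor_contains F D : top_minor F D -> contains_subdivision D F.
Proof.
case=> phi [p [phi_inj p_path p_uniq p_branch p_dis]].
pose walk u v := phi u :: rcons (p u v) (phi v).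
pose e := [rel x y | [exists u : F, [exists v : F, arc u v && infix [:: x; y] (walk u v)]]].
pose S := [set x | [exists u : F, x == phi u]
  || [exists u : F, [exists v : F, arc u v && (x \in p u v)]]].
have phiS u : phi u \in S by rewrite inE; apply/orP; left; apply/existsP; exists u.
have pS u v : arc u v -> all [in S] (p u v).
  move=> uv; apply/allP => x xp; rewrite /= inE; apply/orP; right.
  by apply/existsP; exists u; apply/existsP; exists v; rewrite uv.
have e_irr : irreflexive e.
  move=> x; apply/existsP => - [u /existsP [v /andP [uv /infix_uniq/(_ (p_uniq _ _ uv))]]].
  by rewrite /= inE eqxx.
have S0 : S != set0.
  by have [u _] := card_gt0P (vertex_gt0 F); apply/set0Pn; exists (phi u).
pose q u v : seq {x | x \in S} := pmap insub (p u v).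
have qE u v : arc u v -> map val (q u v) = p u v.
  move=> uv; rewrite (pmap_filter (insubK _)); apply/all_filterP.
  by apply: sub_all (pS _ _ uv) => x xS; rewrite isSome_insub.
pose psi u : {x | x \in S} := Sub (phi u) (phiS u).
have walkE u v : arc u v -> map val (psi u :: rcons (q u v) (psi v)) = walk u v.
  by move=> uv; rewrite /= map_rcons qE.
exists (sub_digraph e_irr S0); split; last first.
  exists val; split; first exact: val_inj.
  move=> a b /existsP [u /existsP [v /andP [uv]]] inf.
  exact: infix_path inf (p_path _ _ uv).
exists psi, q; split.
- by move=> u v /(congr1 val) /phi_inj.
- move=> u v uv; have := walkE _ _ uv; rewrite /= => - [wE].
  change (path (relpre val e) (psi u) (rcons (q u v) (psi v))).
  rewrite -path_map wE; apply: path_infix => x y xy.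
  by apply/existsP; exists u; apply/existsP; exists v; rewrite uv.
- by move=> u v uv; rewrite -(map_inj_uniq val_inj) walkE //; apply: p_uniq.
- by move=> u v w uv; rewrite -(mem_map val_inj) qE //; apply: p_branch.
- move=> u v u' v' uv uv' ne; apply: contra (p_dis _ _ _ _ uv uv' ne).
  case/hasP=> x xq xq'; apply/hasP; exists (val x).
    by rewrite -(qE _ _ uv') map_f.
  by rewrite /= -(qE _ _ uv) map_f.
- move=> a; have := valP a; rewrite inE => /orP [/existsP [u /eqP aE]|].
    by left; exists u; apply: val_inj.
  case/existsP=> u /existsP [v /andP [uv ap]]; right; exists u, v; split=> //.
  by rewrite -(mem_map val_inj) qE.
- move=> a b /existsP [u /existsP [v /andP [uv]]].
  rewrite -walkE // => /infixP [s1 [s2 E]]; exists u, v; split=> //.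
  (* The decomposition of the projected walk is transferred to the walk in the subtype by cutting at
     the same positions. *)
  apply/infixP; exists (take (size s1) (psi u :: rcons (q u v) (psi v))).
  exists (drop (size s1 + 2) (psi u :: rcons (q u v) (psi v))).
  apply: (inj_map val_inj); rewrite !map_cat map_take map_drop E.
  by rewrite take_size_cat // addnC -drop_drop drop_size_cat //= drop0.
Qed.

(** * Composition of topological minors *)

Section Expand.
Variables (D1 D : digraph) (psi : D1 -> D) (q : D1 -> D1 -> seq D).
Hypothesis psi_q : top_minor_by psi q.

(** The interior of the image of the walk from [x] to [z] with interior [l]; both ends are omitted,
    as in the path lists of [top_minor_by]. *)
Fixpoint expand x l z :=
  if l is y :: l' then q x y ++ psi y :: expand y l' z else q x z.

Lemma expand_cons x y l z : expand x (y :: l) z = q x y ++ psi y :: expand y l z.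
Proof. by []. Qed.

(** The arcs traversed by the walk, as consecutive pairs. *)
Definition steps (x : D1) l z := zip (x :: l) (rcons l z).

Lemma mem_steps x l z a b : (a, b) \in steps x l z ->
  a \in x :: l /\ b \in rcons l z.
Proof.
elim: l x => [|y l IH] x; first by rewrite /steps /= inE => /eqP [-> ->]; rewrite !mem_head.
rewrite /steps /= inE => /orP [/eqP [-> ->]|/IH [al bl]]; first by rewrite !mem_head.
by rewrite in_cons al orbT in_cons bl orbT.
Qed.

Lemma steps_arc x l z a b :
  path arc x (rcons l z) -> (a, b) \in steps x l z -> arc a b.
Proof.
elim: l x => [|y l IH] x; rewrite /steps /= !inE.
  by rewrite andbT => xz /eqP [-> ->].
by case/andP => xy /IH H /orP [/eqP [-> ->]|/H].
Qed.

Lemma mem_expand x l z w : w \in expand x l z ->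
  (exists2 y, y \in l & w = psi y) \/
  (exists a b, (a, b) \in steps x l z /\ w \in q a b).
Proof.
elim: l x => [|y l IH] x /=; first by right; exists x, z; rewrite /steps /= inE eqxx.
rewrite mem_cat inE => /or3P [wq|/eqP ->|/IH [[v vl ->]|[a [b [ab wq]]]]].
- by right; exists x, y; rewrite /steps /= inE eqxx.
- by left; exists y; rewrite ?mem_head.
- by left; exists v; rewrite // inE vl orbT.
- by right; exists a, b; split=> //; rewrite /steps /= inE ab orbT.
Qed.

Lemma path_expand x l z :
  path arc x (rcons l z) -> path arc (psi x) (rcons (expand x l z) (psi z)).
Proof.
elim: l x => [|y l IH] x /=; first by rewrite andbT; apply: tm_path.
case/andP=> xy /IH pe; have := tm_path psi_q xy.
by rewrite rcons_cat cat_path rcons_path /= pe andbT.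
Qed.

Lemma psi_expand x l z w :
  path arc x (rcons l z) -> psi w \in expand x l z -> w \in l.
Proof.
move=> pe /mem_expand [[y yl /(tm_inj psi_q) ->] //|[a [b [ab]]]].
by rewrite (negPf (tm_branch psi_q w (steps_arc pe ab))).
Qed.

Lemma q_arc_inj a b c d w : arc a b -> arc c d -> w \in q a b -> w \in q c d ->
  (a, b) = (c, d).
Proof.
move=> ab cd wab wcd; apply/eqP; apply: contraT => /(tm_disjoint psi_q ab cd)/hasP.
by case; exists w.
Qed.

Lemma uniq_expand x l z : path arc x (rcons l z) -> uniq (x :: rcons l z) ->
  uniq (psi x :: rcons (expand x l z) (psi z)).
Proof.
elim: l x => [|y l IH] x; first by rewrite /= andbT => xz _; apply: (tm_uniq psi_q xz).
move=> /andP [xy pe']; rewrite rcons_cons cons_uniq => /andP [xn un].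
have := IH _ pe' un; have := tm_uniq psi_q xy.
rewrite expand_cons rcons_cat rcons_cons !(cons_uniq (psi x)) cat_uniq mem_cat.
rewrite rcons_uniq mem_rcons !in_cons !negb_or.
case/andP=> /andP [xy' xq] /andP [yq qu] eu.
rewrite xq qu eu andbT !andTb; apply/andP; split.
  rewrite xy' andTb mem_rcons in_cons negb_or (inj_eq (tm_inj psi_q)); apply/andP; split.
    by apply: contraNneq xn => ->; rewrite inE mem_rcons mem_head orbT.
  by apply: contra xn => /(psi_expand pe') xl; rewrite inE mem_rcons inE xl !orbT.
rewrite yq andTb; change (~~ has [in q x y] (rcons (expand y l z) (psi z))).
apply/hasPn => w; rewrite mem_rcons inE => /orP [/eqP ->|].
  exact: (tm_branch psi_q).
case/mem_expand => [[v vl ->]|[a [b [ab wab]]]]; first exact: (tm_branch psi_q).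
(* A vertex shared with a later path interior means that the arc from [x] to [y] is traversed again,
   so [x] would be repeated. *)
apply: contra xn => wxy; have [<- _] := q_arc_inj (steps_arc pe' ab) xy wab wxy.
have [+ _] := mem_steps ab; rewrite !inE mem_rcons inE => /orP [->//|->].
by rewrite !orbT.
Qed.

End Expand.

Lemma top_minor_trans F D1 D : top_minor F D1 -> top_minor D1 D -> top_minor F D.
Proof.
case=> phi [p phi_p] [psi [q psi_q]].
exists (psi \o phi), (fun u v => expand psi q (phi u) (p u v) (phi v)); split.
- exact: inj_comp (tm_inj psi_q) (tm_inj phi_p).
- by move=> u v /(tm_path phi_p) /(path_expand psi_q).
- by move=> u v uv; apply: (uniq_expand psi_q); [apply: tm_path uv | apply: tm_uniq uv].
- move=> u v w uv; apply: contra (tm_branch phi_p w uv).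
  exact/(psi_expand psi_q)/(tm_path phi_p).
- move=> u v u' v' uv uv' ne; apply/hasPn => w.
  have pe := tm_path phi_p uv; have pe' := tm_path phi_p uv'.
  have dis y : y \in p u v -> y \in p u' v' -> False.
    by move=> yp yp'; case/hasP: (tm_disjoint phi_p uv uv' ne); exists y.
  case/mem_expand => [[y yp' ->]|[a [b [ab wab]]]].
    by apply/negP => /(psi_expand psi_q pe) yp; apply: (dis y).
  apply/negP => /mem_expand [[y yp wE]|[c [d [cd wcd]]]].
    by have := tm_branch psi_q y (steps_arc pe' ab); rewrite -wE wab.
  (* The two expansions meet inside the image of one arc of [D1]. Its tail lies on two internally
     disjoint paths, so it is the first vertex of both, and its head is likewise the last vertex of
     both. The two arcs of [F] then coincide. *)
  have [aE bE] := q_arc_inj psi_q (steps_arc pe' ab) (steps_arc pe cd) wab wcd.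
  subst c d; have [ap' bp'] := mem_steps ab; have [ap bp] := mem_steps cd.
  move: ap ap' bp bp'; rewrite !mem_rcons !inE.
  case/orP=> [/eqP aE|ap]; last first.
    case/orP=> [/eqP aE|ap']; last by case: (dis a).
    by move: (tm_branch phi_p u' uv); rewrite -aE ap.
  case/orP=> [/eqP aE'|ap']; last first.
    by move: (tm_branch phi_p u uv'); rewrite -aE ap'.
  have uu : u = u' by apply: (tm_inj phi_p); rewrite -aE -aE'.
  case/orP=> [/eqP bE|bp]; last first.
    case/orP=> [/eqP bE|bp']; last by case: (dis b).
    by move: (tm_branch phi_p v' uv); rewrite -bE bp.
  case/orP=> [/eqP bE'|bp']; last first.
    by move: (tm_branch phi_p v uv'); rewrite -bE bp'.
  have vv : v = v' by apply: (tm_inj phi_p); rewrite -bE -bE'.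
  by rewrite uu vv eqxx in ne.
Qed.

Lemma sub_digraph_top_minor (D : digraph) (S : {set D}) (e : rel D)
    (e_irr : irreflexive e) (S0 : S != set0) (q : D -> D -> seq D) :
  (forall u v, u \in S -> v \in S -> e u v ->
     [/\ path arc u (rcons (q u v) v), uniq (u :: rcons (q u v) v)
       & {in q u v, forall w, w \notin S}]) ->
  (forall u v u' v' w, u \in S -> v \in S -> u' \in S -> v' \in S ->
     e u v -> e u' v' -> w \in q u v -> w \in q u' v' -> (u, v) = (u', v')) ->
  top_minor (sub_digraph e_irr S0) D.
Proof.
move=> qP q_dis; exists val, (fun a b => q (val a) (val b)); split.
- exact: val_inj.
- by move=> a b /(qP _ _ (valP a) (valP b)) [].
- by move=> a b /(qP _ _ (valP a) (valP b)) [].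
- move=> a b c /(qP _ _ (valP a) (valP b)) [_ _ qS]; apply/negP => /qS.
  by rewrite (valP c).
- move=> a b a' b' ab ab' ne; apply/hasPn => w wq'; apply/negP => wq.
  have [/val_inj aE /val_inj bE] := q_dis _ _ _ _ _ (valP a) (valP b) (valP a')
    (valP b') ab ab' wq wq'.
  by rewrite aE bE eqxx in ne.
Qed.

Lemma uniq_flatten_nth (T : eqType) (ss : seq (seq T)) i j x :
  uniq (flatten ss) -> x \in nth [::] ss i -> x \in nth [::] ss j -> i = j.
Proof.
elim: ss i j => [|s ss IH] i j /=; first by rewrite nth_nil.
rewrite cat_uniq => /and3P [_ /hasPn dis us].
have clash n : x \in s -> x \in nth [::] ss n -> False.
  move=> xs xn; suff /dis : x \in flatten ss by rewrite /= xs.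
  apply/flattenP; exists (nth [::] ss n) => //; apply: mem_nth.
  by rewrite ltnNge; apply: contraL xn => /(nth_default [::]) ->.
case: i j => [|i] [|j] //= xi xj; first by case: (clash j).
  by case: (clash i).
by rewrite (IH i j).
Qed.

(** With branch vertices and paths tabulated in lists, injectivity and all disjointness conditions
    become a single [uniq]. *)
Lemma top_minor_intro (F D : digraph) (vs : seq F) (ars : seq (F * F)) d
    (ws : seq D) (ps : seq (seq D)) :
  let phi u := nth d ws (index u vs) in
  let p u v := nth [::] ps (index (u, v) ars) in
  (forall u, u \in vs) -> size ws = size vs ->
  (forall u v, arc u v -> (u, v) \in ars /\ path arc (phi u) (rcons (p u v) (phi v))) ->
  uniq (ws ++ flatten ps) -> top_minor F D.
Proof.
move=> phi p vsP sz arP; rewrite cat_uniq => /and3P [uw /hasPn dis up].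
have phi_in u : phi u \in ws by rewrite mem_nth // sz index_mem.
have phi_inj : injective phi.
  move=> u v /eqP; rewrite nth_uniq ?sz ?index_mem // => /eqP E.
  by rewrite -(nth_index u (vsP u)) E nth_index.
have p_flat u v x : x \in p u v -> x \in flatten ps.
  move=> xp; apply/flattenP; exists (p u v) => //; apply: mem_nth.
  by rewrite ltnNge; apply: contraL xp; rewrite /p => /(nth_default [::]) ->.
have p_branch u v w : phi w \notin p u v.
  by apply/negP => /p_flat/dis; rewrite /= phi_in.
exists phi, p; split=> //.
- by move=> u v /arP [].
- move=> u v uv; rewrite cons_uniq mem_rcons in_cons negb_or rcons_uniq !p_branch.
  rewrite (inj_eq phi_inj); apply/andP; split.
    by rewrite andbT; apply: contraTneq uv => ->; rewrite arc_irrefl.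
  have [ps_in|] := boolP (p u v \in ps).
    by move: up; case/splitPr: ps_in => s1 s2;
      rewrite flatten_cat /= !cat_uniq => /and4P [_ _ ->].
  rewrite /p; case: (ltnP (index (u, v) ars) (size ps)) => [lt|le _].
    by rewrite mem_nth.
  by rewrite nth_default.
- move=> u v u' v' uv uv' ne; apply/hasPn => x xp'; apply: contra ne => xp.
  have E := uniq_flatten_nth up xp xp'.
  have [uvA _] := arP _ _ uv; have [uvA' _] := arP _ _ uv'.
  by rewrite -(nth_index (u, v) uvA) E nth_index.
Qed.

(** * The two orientations of K4 without sink *)

Section FourVertices.
Variables (F D : digraph) (a b c d : F).
Hypotheses (abcd : uniq [:: a; b; c; d]) (all4 : forall u : F, u \in [:: a; b; c; d]).

Lemma neq4 : ((a == b) = false) * ((a == c) = false) * ((a == d) = false)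
  * ((b == c) = false) * ((b == d) = false) * ((c == d) = false)
  * ((b == a) = false) * ((c == a) = false) * ((d == a) = false)
  * ((c == b) = false) * ((d == b) = false) * ((d == c) = false).
Proof.
move: abcd; rewrite /= !inE !negb_or -!andbA !andbT.
case/and5P=> ab ac ad bc /andP [bd cd].
by do !split; apply/negbTE => //; rewrite eq_sym.
Qed.

Lemma source_triangle_top_minor s l1 l2 l3 (f1 f2 f3 m1 m2 m3 : seq D) :
  (forall u v : F, arc u v ->
     (u, v) \in [:: (a, b); (a, c); (a, d); (b, c); (c, d); (d, b)]) ->
  path arc s (rcons f1 l1) -> path arc s (rcons f2 l2) -> path arc s (rcons f3 l3) ->
  path arc l1 (rcons m1 l2) -> path arc l2 (rcons m2 l3) -> path arc l3 (rcons m3 l1) ->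
  uniq ([:: s; l1; l2; l3] ++ f1 ++ f2 ++ f3 ++ m1 ++ m2 ++ m3) -> top_minor F D.
Proof.
move=> arcs p1 p2 p3 q1 q2 q3 un.
apply: (@top_minor_intro _ _ [:: a; b; c; d]
  [:: (a, b); (a, c); (a, d); (b, c); (c, d); (d, b)] s [:: s; l1; l2; l3]
  [:: f1; f2; f3; m1; m2; m3] all4 erefl _); last by rewrite /= cats0.
move=> u v /arcs uv; split=> //; move: uv; rewrite !inE.
by case/or4P => [||| /or3P []] /eqP [-> ->]; rewrite /= ?xpair_eqE ?eqxx ?neq4.
Qed.

Lemma strong_top_minor l1 l2 l3 l4 (f m1 m2 m3 m4 g : seq D) :
  (forall u v : F, arc u v ->
     (u, v) \in [:: (a, b); (b, c); (b, d); (a, c); (c, d); (d, a)]) ->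
  path arc l1 (rcons f l2) -> path arc l2 (rcons m1 l3) -> path arc l2 (rcons m2 l4) ->
  path arc l1 (rcons m3 l3) -> path arc l3 (rcons m4 l4) -> path arc l4 (rcons g l1) ->
  uniq ([:: l1; l2; l3; l4] ++ f ++ m1 ++ m2 ++ m3 ++ m4 ++ g) -> top_minor F D.
Proof.
move=> arcs p1 p2 p3 q1 q2 q3 un.
apply: (@top_minor_intro _ _ [:: a; b; c; d]
  [:: (a, b); (b, c); (b, d); (a, c); (c, d); (d, a)] l1 [:: l1; l2; l3; l4]
  [:: f; m1; m2; m3; m4; g] all4 erefl _); last by rewrite /= cats0.
move=> u v /arcs uv; split=> //; move: uv; rewrite !inE.
by case/or4P => [||| /or3P []] /eqP [-> ->]; rewrite /= ?xpair_eqE ?eqxx ?neq4.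
Qed.

End FourVertices.

Definition source_triangle_arcs (T : eqType) (a b c d : T) :=
  [:: (a, b); (a, c); (a, d); (b, c); (c, d); (d, b)].

(** The Hamiltonian cycle [a], [b], [c], [d] with the chords from [a] to [c] and from [b] to [d]. *)
Definition strong_arcs (T : eqType) (a b c d : T) :=
  [:: (a, b); (b, c); (b, d); (a, c); (c, d); (d, a)].

Lemma K4_no_sink (F : digraph) : K4_orientation F -> (forall u : F, ~ sink u) ->
  exists a b c d : F, [/\ uniq [:: a; b; c; d], (forall u, u \in [:: a; b; c; d]) &
    (forall u v : F, arc u v -> (u, v) \in source_triangle_arcs a b c d) \/
    (forall u v : F, arc u v -> (u, v) \in strong_arcs a b c d)].
Proof.
case=> F4 tour nosink.
have arcV (u v : F) : arc u v -> arc v u = false.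
  move=> uv; have [E|/tour] := eqVneq u v; first by rewrite E arc_irrefl in uv.
  by rewrite uv => /negbTE.
have out (u : F) : exists v, arc u v.
  have : 0 < outdeg u by rewrite lt0n; apply/eqP/nosink.
  by case/card_gt0P => v; rewrite inE; exists v.
(* It suffices that the six listed pairs are arcs: they cover each pair of vertices in one
   direction, and opposite arcs do not coexist in [F]. *)
suff [a [b [c [d [un all4 arcs]]]]] : exists a b c d : F, [/\ uniq [:: a; b; c; d],
    (forall u, u \in [:: a; b; c; d]) &
    all (fun x => arc x.1 x.2) (source_triangle_arcs a b c d) ||
    all (fun x => arc x.1 x.2) (strong_arcs a b c d)].
  exists a, b, c, d; split=> //.
  have cov u v : arc u v -> ((u, v) \in source_triangle_arcs a b c d) ||
     ((v, u) \in source_triangle_arcs a b c d).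
    have : u \in [:: a; b; c; d] by []. have : v \in [:: a; b; c; d] by [].
    rewrite !inE !xpair_eqE => /or4P [] /eqP -> /or4P [] /eqP ->;
    by rewrite ?eqxx ?orbT // arc_irrefl.
  have cov' u v : arc u v -> ((u, v) \in strong_arcs a b c d) ||
     ((v, u) \in strong_arcs a b c d).
    have : u \in [:: a; b; c; d] by []. have : v \in [:: a; b; c; d] by [].
    rewrite !inE !xpair_eqE => /or4P [] /eqP -> /or4P [] /eqP ->;
    by rewrite ?eqxx ?orbT // arc_irrefl.
  case/orP: arcs => /allP arcs; [left|right] => u v uv.
    by case/orP: (cov _ _ uv) => // /arcs /arcV; rewrite uv.
  by case/orP: (cov' _ _ uv) => // /arcs /arcV; rewrite uv.
have : uniq (enum F) by apply: enum_uniq.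
have : forall u, u \in enum F by move=> u; rewrite mem_enum.
have : size (enum F) = 4 by rewrite -cardE.
case: (enum F) => [|a [|b [|c [|d []]]]] // _ all4 un.
have neq := neq4 un.
have sym (u v : F) : (u == v) = false -> arc v u = ~~ arc u v.
  by move/negbT/tour; case: (arc u v); case: (arc v u).
have out4 (u : F) : [|| arc u a, arc u b, arc u c | arc u d].
  have [v uv] := out u; have := all4 v.
  by rewrite !inE => /or4P [] /eqP <-; rewrite uv ?orbT.
have := out4 a; have := out4 b; have := out4 c; have := out4 d.
rewrite !arc_irrefl (sym a b) ?neq // (sym a c) ?neq // (sym a d) ?neq //.
rewrite (sym b c) ?neq // (sym b d) ?neq // (sym c d) ?neq //.
have pick (w x y z : F) : all (fun x => arc x.1 x.2) (source_triangle_arcs w x y z) ||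
    all (fun x => arc x.1 x.2) (strong_arcs w x y z) -> uniq [:: w; x; y; z] ->
    exists a b c d : F, [/\ uniq [:: a; b; c; d], (forall u, u \in [:: a; b; c; d]) &
    all (fun x => arc x.1 x.2) (source_triangle_arcs a b c d) ||
    all (fun x => arc x.1 x.2) (strong_arcs a b c d)].
  move=> arcs unw; exists w, x, y, z; split=> // u.
  have sub : {subset [:: w; x; y; z] <= [:: a; b; c; d]} by move=> v _; apply: all4.
  by have [_ ->] := uniq_min_size unw sub isT.
move: (sym a b) (sym a c) (sym a d) (sym b c) (sym b d) (sym c d); rewrite !neq.
case ab: (arc a b); case ac: (arc a c); case ad: (arc a d);
case bc: (arc b c); case bd: (arc b d); case cd: (arc c d) => //=.
all: move=> /(_ erefl) ba /(_ erefl) ca /(_ erefl) da /(_ erefl) cb /(_ erefl) db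
  /(_ erefl) dc _ _ _ _.
all: have E := (ab, ac, ad, bc, bd, cd, ba, ca, da, cb, db, dc).
(* Each of the 32 labelled tournaments without sink matches some relabelling. *)
all: let t w x y z := (apply: (pick w x y z); [by rewrite /= !E | by rewrite /= !inE !neq]) in
  first [t a b c d | t a b d c | t a c b d | t a c d b | t a d b c | t a d c b
    | t b a c d | t b a d c | t b c a d | t b c d a | t b d a c | t b d c a | t c a b d
      | t c a d b | t c b a d | t c b d a | t c d a b | t c d b a | t d a b c
        | t d a c b | t d b a c | t d b c a | t d c a b | t d c b a].
Qed.

(** * Fans to a cycle *)

(** After rotation to [x], the vertices [y] and [z] follow in an unknown order, hence the primed
    names. *)
Lemma cycle_split3 (T : eqType) (e : rel T) C x y z :
  cycle e C -> uniq C -> x \in C -> y \in C -> z \in C -> uniq [:: x; y; z] ->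
  exists y' z' m1 m2 m3, [/\ (y', z') = (y, z) \/ (y', z') = (z, y),
    path e x (rcons m1 y'), path e y' (rcons m2 z'), path e z' (rcons m3 x) &
    perm_eq C (x :: m1 ++ y' :: m2 ++ z' :: m3)].
Proof.
move=> cC uC xC yC zC; rewrite /= !inE andbT negb_or => /andP [/andP [xy xz] yz].
have [i C' rE] := rot_to xC; move: cC; rewrite -(rot_cycle i) rE.
have permC : perm_eq C (x :: C') by rewrite -rE perm_sym perm_rot.
have yC' : y \in C' by move: yC; rewrite (perm_mem permC) inE eq_sym (negbTE xy).
have zC' : z \in C' by move: zC; rewrite (perm_mem permC) inE eq_sym (negbTE xz).
have split_path y' z' m1 m2 m3 : cycle e (x :: m1 ++ y' :: m2 ++ z' :: m3) ->
    [/\ path e x (rcons m1 y'), path e y' (rcons m2 z') & path e z' (rcons m3 x)].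
  rewrite /= -cat_rcons -[m2 ++ _]cat_rcons !rcons_cat !cat_path !last_rcons.
  by case/and3P.
case/splitPr: yC' permC zC' {rE} => p1 p2 permC.
rewrite mem_cat inE eq_sym (negbTE yz) /= => /orP [] /splitPr zp.
  case: zp permC => q1 q2; rewrite -catA cat_cons => permC /split_path [? ? ?].
  by exists z, y, q1, q2, p2; split=> //; right.
case: zp permC => q1 q2 permC /split_path [? ? ?].
by exists y, z, p1, q1, q2; split=> //; left.
Qed.

(** Passes from the order along fan and cycle to the one in [source_triangle_top_minor], by
    comparing multiplicities. *)
Lemma perm_source_triangle (T : eqType) (s l1 l2 l3 : T) f1 f2 f3 m1 m2 m3 :
  perm_eq (s :: (f1 ++ f2 ++ f3) ++ l1 :: m1 ++ l2 :: m2 ++ l3 :: m3)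
    ([:: s; l1; l2; l3] ++ f1 ++ f2 ++ f3 ++ m1 ++ m2 ++ m3).
Proof.
apply/permP => P; do 4!rewrite ?count_cat /=.
move: (nat_of_bool _) (nat_of_bool _) (nat_of_bool _) (nat_of_bool _) => ? ? ? ?.
by move: (count _ _) (count _ _) (count _ _) (count _ _) (count _ _) (count _ _) =>
  ? ? ? ? ? ?; lia.
Qed.

Lemma perm_strong (T : eqType) (s c l1 l2 : T) f1 f2 m1 m2 m3 :
  perm_eq (s :: (f1 ++ f2) ++ c :: m1 ++ l1 :: m2 ++ l2 :: m3)
    ([:: c; s; l1; l2] ++ [::] ++ f1 ++ f2 ++ m1 ++ m2 ++ m3).
Proof.
apply/permP => P; do 4!rewrite ?count_cat /=.
move: (nat_of_bool _) (nat_of_bool _) (nat_of_bool _) (nat_of_bool _) => ? ? ? ?.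
by move: (count _ _) (count _ _) (count _ _) (count _ _) (count _ _) => ? ? ? ? ?; lia.
Qed.

Lemma fan_cycle_top_minor (F D : digraph) (C : seq D) (s c : D) :
  K4_orientation F -> (forall u : F, ~ sink u) ->
  cycle arc C -> uniq C -> s \notin C -> c \in C -> arc c s ->
  (forall X : {set D}, #|X| < 3 -> s \notin X ->
     exists2 y, y \in C & connect (avoid arc X) s y) ->
  top_minor F D.
Proof.
move=> hF hsink cC uC sC cC0 cs reach.
have [|X X3 sX|p [l [plP dis]]] := @fan D arc [set y in C] s 3.
- by rewrite inE.
- by have [y yC sy] := reach X X3 sX; exists y; rewrite ?inE.
have pP i : path arc s (rcons (p i) (l i)) by have [] := plP i.
have lC i : l i \in C by have [_ _] := plP i; rewrite inE.
have pC i x : x \in p i -> x \notin C.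
  by have [_ _ _ /hasPn pC] := plP i; move/pC; rewrite /= inE.
have pu i : uniq (p i).
  by have [_] := plP i; rewrite /= rcons_uniq => /and3P [].
have ps i : s \notin p i.
  by have [_] := plP i; rewrite /= mem_rcons inE negb_or => /andP [/andP []].
have pdis i j : i != j -> ~~ has [in p i] (p j).
  move=> ij; apply/hasPn => x xj; apply: contra ij => xi; apply/eqP.
  by apply: (dis i j x); rewrite mem_rcons inE ?xi ?xj orbT.
have ldis i j : i != j -> l i != l j.
  apply: contraNneq => lij; apply/eqP/(dis i j (l i)); first by rewrite mem_rcons mem_head.
  by rewrite lij mem_rcons mem_head.
have uniq_fans (ks : seq 'I_3) C' : uniq ks -> perm_eq C C' ->
    uniq (s :: flatten [seq p i | i <- ks] ++ C').
  move=> uks CC'; rewrite cons_uniq mem_cat negb_or -(perm_mem CC') sC andbT.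
  rewrite cat_uniq -(perm_uniq CC') uC andbT; apply/and3P; split.
  - by apply/negP => /flattenP [_ /mapP [i _ ->]]; rewrite (negbTE (ps i)).
  - elim: ks uks => //= i ks IH /andP [iks /IH uf]; rewrite cat_uniq pu uf andbT /=.
    apply/hasPn => x /flattenP [_ /mapP [j jks ->] xj].
    by apply: (hasPn (pdis i j _) _ xj); apply: contraNneq iks => ->.
  - apply/hasPn => x; rewrite -(perm_mem CC') => xC.
    by apply/negP => /flattenP [_ /mapP [i _ ->]] /pC; rewrite xC.
pose i0 : 'I_3 := @Ordinal 3 0 isT; pose i1 : 'I_3 := @Ordinal 3 1 isT;
  pose i2 : 'I_3 := @Ordinal 3 2 isT.
have [a [b [c' [d [un all4 [arcs|arcs]]]]]] := K4_no_sink hF hsink.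
  have [|y [z [m1 [m2 [m3 [yz q1 q2 q3 permC]]]]]] := cycle_split3 cC uC (lC i0) (lC i1)
    (lC i2).
    by rewrite /= !inE negb_or !ldis.
  (* The fan paths are renamed in the order in which the cycle visits their leaves. *)
  have [j1 [j2 [yE zE uj]]] : exists j1 j2, [/\ y = l j1, z = l j2 & uniq [:: i0; j1; j2]].
    by case: yz => - [-> ->]; [exists i1, i2 | exists i2, i1].
  subst y z.
  apply: (source_triangle_top_minor un all4 arcs (pP i0) (pP j1) (pP j2) q1 q2 q3).
  rewrite -(perm_uniq (s1 := s :: flatten [seq p i | i <- [:: i0; j1;
    j2]] ++ (l i0 :: m1 ++ l j1 :: m2 ++ l j2 :: m3))).
    exact: uniq_fans.
  by rewrite [flatten _]/= cats0 perm_source_triangle.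
(* At most one of the three leaves is [c]. Two others, with [c] and [s], become the branch vertices
   of the strong tournament. *)
have [i [j [ij ic jc]]] : exists i j, [/\ i != j, l i != c & l j != c].
  have [E0|ne0] := eqVneq (l i0) c.
    by exists i1, i2; rewrite -E0 !ldis.
  have [E1|ne1] := eqVneq (l i1) c; last by exists i0, i1.
  by exists i0, i2; rewrite -E1 !ldis.
have [|y [z [m1 [m2 [m3 [yz q1 q2 q3 permC]]]]]] := cycle_split3 cC uC cC0 (lC i) (lC j).
  by rewrite /= !inE negb_or !(eq_sym c) ic jc ldis.
have [j1 [j2 [yE zE uj]]] : exists j1 j2, [/\ y = l j1, z = l j2 & uniq [:: j1; j2]].
  case: yz => - [-> ->]; [exists i, j | exists j, i]; split=> //; rewrite /= inE andbT //.
  by rewrite eq_sym.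
subst y z.
apply: (@strong_top_minor _ _ a b c' d un all4 c s (l j1) (l j2) [::] (p j1) (p j2) m1 m2
  m3) => //.
  by rewrite /= cs.
rewrite -(perm_uniq (s1 := s :: flatten [seq p i | i <- [:: j1;
  j2]] ++ (c :: m1 ++ l j1 :: m2 ++ l j2 :: m3))).
  exact: uniq_fans.
by rewrite [flatten _]/= cats0 perm_strong.
Qed.

(** * Digraphs with one exceptional vertex *)

Lemma connect_closed (V : finType) (e : rel V) (T : {set V}) x y :
  (forall a b, a \in T -> e a b -> b \in T) -> x \in T -> connect e x y -> y \in T.
Proof.
move=> cl + /connectP [p pe ->]; elim: p x pe => //= z p IH x /andP [xz pe] xT.
exact: IH pe (cl _ _ xT xz).
Qed.

Lemma sub_connect_avoid (V : finType) (e : rel V) (X Y : {set V}) x y :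
  X \subset Y -> connect (avoid e Y) x y -> connect (avoid e X) x y.
Proof.
move=> /subsetP XY; apply: connect_sub => a b /andP [ab bY].
by apply: connect1; rewrite /= ab; apply: contra bY; apply: XY.
Qed.

(** * Out-neighbourhoods and reachable sets *)

Section OutNeighbours.
Variable D : digraph.
Implicit Types (R X : {set D}).

Definition outnbrs R := [set y | (y \notin R) && [exists x in R, arc x y]].

Definition reach X z := [set t | connect (avoid arc X) z t].

Lemma mem_outnbrs R x y : x \in R -> y \notin R -> arc x y -> y \in outnbrs R.
Proof. by move=> xR yR xy; rewrite inE yR; apply/existsP; exists x; rewrite xR. Qed.

Lemma outnbrsP R y :
  reflect (y \notin R /\ exists2 x, x \in R & arc x y) (y \in outnbrs R).
Proof.
rewrite inE; apply: (iffP andP) => [[yR /existsP [x /andP [xR xy]]]|[yR [x xR xy]]].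
  by split=> //; exists x.
by split=> //; apply/existsP; exists x; rewrite xR.
Qed.

Lemma reach_self X z : z \in reach X z.
Proof. by rewrite inE connect0. Qed.

Lemma reach_arc X z x y : x \in reach X z -> arc x y -> y \notin X -> y \in reach X z.
Proof.
rewrite !inE => zx xy yX; apply: connect_trans zx (connect1 _).
by rewrite /= xy.
Qed.

Lemma reach_notin X z x : z \notin X -> x \in reach X z -> x \notin X.
Proof.
move=> zX; rewrite inE -in_setC; apply: connect_closed; last by rewrite inE.
by move=> a b _ /andP [_]; rewrite inE.
Qed.

(** The source of small sets: what [z] reaches while avoiding [X] has at most [#|X|]
    out-neighbours. *)
Lemma outnbrs_reach X z : outnbrs (reach X z) \subset X.
Proof.
apply/subsetP => y /outnbrsP [yr [x xr xy]].
by apply: contraR yr; apply: reach_arc xr xy.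
Qed.

(** Avoidance of [r] is stated separately. It passes to subsets, so a minimal small set that avoids
    [r] is minimal among those avoiding [r], and conversely. *)
Definition small R := (R != set0) && (#|outnbrs R| <= 2).

End OutNeighbours.

(** * The induction step *)

Section Step.
Variables (F D : digraph) (r : D).
Hypotheses (hF : K4_orientation F) (hsink : forall u : F, ~ sink u).
Hypothesis hr : 0 < outdeg r.
Hypothesis hD : forall u : D, u != r -> 3 <= outdeg u.
Hypothesis IH : forall (D' : digraph) (r' : D'), #|D'| < #|D| -> 0 < outdeg r' ->
  (forall u : D', u != r' -> 3 <= outdeg u) -> top_minor F D'.
Implicit Types (R X S : {set D}).

(** The common form of all reductions: [a] witnesses that [S] is smaller, [w] is the new exceptional
    vertex, and [q] realizes the arcs of [e] by paths outside [S]. *)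
Lemma smaller_top_minor S (e : rel D) (q : D -> D -> seq D) (w a : D) :
  a \notin S -> w \in S -> irreflexive e ->
  (forall u, u \in S -> u != w -> 3 <= #|[set v in S | e u v]|) ->
  (exists2 v, v \in S & e w v) ->
  (forall u v, u \in S -> v \in S -> e u v ->
     [/\ path arc u (rcons (q u v) v), uniq (u :: rcons (q u v) v)
       & {in q u v, forall x, x \notin S}]) ->
  (forall u v u' v' x, u \in S -> v \in S -> u' \in S -> v' \in S ->
     e u v -> e u' v' -> x \in q u v -> x \in q u' v' -> (u, v) = (u', v')) ->
  top_minor F D.
Proof.
move=> aS wS e_irr degS degw qP q_dis.
have S0 : S != set0 by apply/set0Pn; exists w.
apply: (top_minor_trans _ (sub_digraph_top_minor e_irr S0 qP q_dis)).
apply: (@IH (sub_digraph e_irr S0) (Sub w wS : {x | x \in S})).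
- rewrite card_sub_digraph; apply: proper_card; apply/properP; split; first exact/subsetP.
  by exists a.
- rewrite outdeg_sub_digraph; have [v vS wv] := degw.
  by apply/card_gt0P; exists v; rewrite inE vS.
- move=> u uw; rewrite outdeg_sub_digraph; apply: degS; first exact: (valP u).
  by apply: contra uw => /eqP uw; apply/eqP/val_inj.
Qed.

Lemma not_strong x y : ~~ connect (@arc D) x y -> top_minor F D.
Proof.
move=> xy; pose S := [set t | connect (@arc D) x t].
have S_cl u v : u \in S -> arc u v -> v \in S.
  by rewrite !inE => xu uv; apply: connect_trans xu (connect1 uv).
have degS u : u \in S -> #|[set v in S | arc u v]| = outdeg u.
  move=> uS; apply: eq_card => v; rewrite !inE andb_idl // => uv.
  by have := S_cl _ _ uS uv; rewrite inE.
(* [S] is closed under arcs, so out-degrees persist. If [r] is lost, any vertex can be the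
   exceptional one. *)
pose w := if r \in S then r else x.
have wS : w \in S by rewrite /w; case: ifP => // _; rewrite inE connect0.
apply: (@smaller_top_minor S arc (fun _ _ => [::]) w y) => //.
- by rewrite inE.
- exact: arc_irrefl.
- move=> u uS uw; rewrite degS //; apply: hD; apply: contraNneq uw => ur.
  by rewrite /w -ur uS.
- have : 0 < #|[set v in S | arc w v]|.
    rewrite degS // /w; case: ifPn => // rS; apply: ltn_trans (hD _) => //.
    by apply: contraNneq rS => <-; rewrite inE connect0.
  by case/card_gt0P => v; rewrite inE => /andP []; exists v.
- move=> u v uS vS uv /=; rewrite uv inE !andbT; split=> //.
  by apply: contraTneq uv => ->; rewrite arc_irrefl.
Qed.

Hypothesis strong : forall x y : D, connect (@arc D) x y.

Lemma outnbrs_neq0 R a : R != set0 -> a \notin R -> outnbrs R != set0.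
Proof.
move=> /set0Pn [x xR] aR; apply: contra aR => /eqP R0.
apply: connect_closed xR (strong x a) => u v uR uv.
by apply: contraT => vR; have := mem_outnbrs uR vR uv; rewrite R0 inE.
Qed.

(** By strongness the set reached from [w] outside [R] has an out-neighbour, and this can only lie
    in [R]. *)
Lemma enter R w : R != set0 -> w \notin R ->
  exists l y, [/\ l \notin R, connect (avoid arc R) w l, arc l y & y \in R].
Proof.
move=> /set0Pn [x xR] wR.
have [y yR /outnbrsP [_ [l lw ly]]] : exists2 y, y \in R & y \in outnbrs (reach R w).
  have xr : x \notin reach R w.
    by apply: contraL xR; apply: reach_notin.
  have /set0Pn [y yo] : outnbrs (reach R w) != set0.
    by apply: outnbrs_neq0 xr; apply/set0Pn; exists w; apply: reach_self.
  by exists y => //; apply: (subsetP (outnbrs_reach R w)).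
exists l, y; split=> //; first exact: reach_notin lw.
by move: lw; rewrite inE.
Qed.

Lemma card_out_in R S u : u \in R -> R :|: outnbrs R \subset S ->
  #|[set v in S | arc u v]| = outdeg u.
Proof.
move=> uR /subsetP RS; apply: eq_card => v; rewrite !inE andb_idl // => uv.
apply: RS; rewrite inE; have [//|vR] := boolP (v \in R).
exact: mem_outnbrs uR vR uv.
Qed.

(** Vertices of [R] keep their out-degree since all heads lie in [z |: R]; [z] becomes exceptional,
    with one arc into [R]. *)
Lemma one_cut R a b : R != set0 -> r \notin R -> #|outnbrs R| <= 1 ->
  a != b -> a \notin R -> b \notin R -> top_minor F D.
Proof.
move=> R0 rR R1 ab aR bR.
have /cards1P [z Rz] : #|outnbrs R| == 1.
  by rewrite eqn_leq R1 card_gt0 (outnbrs_neq0 R0 aR).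
have zR : z \notin R by have /outnbrsP [] : z \in outnbrs R by rewrite Rz set11.
have [l [y [lR /connect_uniqP [p [pe pl pu]] ly yR]]] := enter R0 zR.
move: pe; rewrite path_avoid => /andP [pe /hasPn pR].
(* One of [a] and [b] differs from [z] and disappears, so the digraph shrinks. *)
have [c [cR cz]] : exists c, c \notin R /\ c != z.
  by have [az|] := eqVneq a z; [exists b; rewrite bR -az eq_sym | exists a].
apply: (@smaller_top_minor (z |: R) (fun u v => if u == z then v == y else arc u v)
   (fun u _ => if u == z then p else [::]) z c).
- by rewrite !inE negb_or cz.
- by rewrite setU11.
- move=> u /=; case: eqP => [->|_]; last exact: arc_irrefl.
  by apply: contraNF zR => /eqP ->.
- move=> u; rewrite 2!inE => /orP [->//|uR] uz; rewrite (negbTE uz).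
  rewrite (card_out_in uR) ?Rz 1?setUC //; apply: hD.
  by apply: contraNneq rR => <-.
- by exists y; rewrite ?eqxx // inE yR orbT.
- move=> u v; rewrite 2!inE => uS vS; case: (eqVneq u z) uS => [-> _ /eqP ->|uz /= uR uv].
    rewrite rcons_path pe pl ly; split=> //.
      rewrite -rcons_cons rcons_uniq pu andbT inE negb_or.
      apply/andP; split; first by apply: contraNneq zR => <-.
      by apply: contraL yR; apply: pR.
    move=> x xp; rewrite !inE negb_or pR // andbT.
    by apply: contraTneq pu => <-; rewrite /= xp.
  rewrite /= uv inE !andbT; split=> //.
  by apply: contraTneq uv => ->; rewrite arc_irrefl.
- move=> u v u' v' x _ _ _ _; case: (eqVneq u z) => // ->; case: (eqVneq u' z) => // ->.
  by move=> /eqP -> /eqP ->.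
Qed.

(** * Minimal sets with at most two out-neighbours *)

Section MinimalSet.
Variables (R : {set D}).
Hypotheses (Rmin : minset (@small D) R) (rR : r \notin R).

Lemma min_neq0 : R != set0.
Proof. by have /andP [] := minsetp Rmin. Qed.

Lemma min_card : #|outnbrs R| <= 2.
Proof. by have /andP [] := minsetp Rmin. Qed.

Lemma min_sub R' : R' \subset R -> R' != set0 -> #|outnbrs R'| <= 2 -> R' = R.
Proof. by move=> sub R0 R2; apply: (minsetinf Rmin) => //; rewrite /small R0. Qed.

(** Minimality makes all of [R] reachable from [y] inside [R]. A path that covers [R] is shortened
    using the out-degree of [y]. *)
Lemma inside_path z y : z \in outnbrs R -> y \in R ->
  exists q s, [/\ path arc y q, uniq (y :: q), {subset y :: q <= R},
    arc (last y q) z & s \in R /\ s \notin y :: q].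
Proof.
move=> zo yR; have [zR [u uR uz]] := outnbrsP _ _ zo.
have reachR : reach (~: R) y = R.
  have sub : reach (~: R) y \subset R.
    by apply/subsetP => x /reach_notin; rewrite !inE !negbK; apply.
  apply: min_sub => //; first by apply/set0Pn; exists y; apply: reach_self.
  apply: leq_trans min_card; apply: subset_leq_card; apply/subsetP => v vo.
  have [vr [x xr xv]] := outnbrsP _ _ vo.
  have := subsetP (outnbrs_reach _ _) _ vo; rewrite inE => vR.
  exact: mem_outnbrs (subsetP sub _ xr) vR xv.
have : u \in reach (~: R) y by rewrite reachR.
rewrite inE => /connect_uniqP [q [qe ql qu]].
have {qe} [qe qR] : path arc y q /\ {subset y :: q <= R}.
  move: qe; rewrite path_avoid => /andP [qe /hasPn qR]; split=> // x.
  by rewrite inE => /orP [/eqP ->//|/qR]; rewrite /= inE negbK.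
have {u uR uz ql} qz : arc (last y q) z by rewrite ql.
have y3 : 3 <= outdeg y by apply: hD; apply: contraNneq rR => <-.
have [n] := ubnP (size q); elim: n q qe qR qu qz => // n IHn q qe qR qu qz le_n.
have [/subsetP sub|/subsetPn [s sR sq]] := boolP (R \subset [set x in y :: q]); last first.
  by exists q, s; split=> //; split=> //; move: sq; rewrite inE.
(* [B] holds the successor of [y] on the path and the out-neighbour of [R] other than [z], if any.
   The default [y] is harmless since there are no loops. A third out-neighbour of [y] is either
   further along the path, giving a shortcut, or [z] itself. *)
pose B := head y q |: (outnbrs R :\ z).
have B2 : #|B| <= 2.
  rewrite cardsU1; have := min_card; rewrite (cardsD1 z) zo.
  by apply: leq_trans; rewrite leq_add2r leq_b1.
have /subsetPn [x] : ~~ ([set v | arc y v] \subset B).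
  by apply: contraTN y3 => /subset_leq_card le; rewrite -ltnNge (leq_ltn_trans le).
rewrite inE => yx; rewrite in_setU1 in_setD1 negb_or negb_and negbK => /andP [xh xo].
have [xR|xR] := boolP (x \in R).
  have := sub _ xR; rewrite !inE => /orP [/eqP xy|xq].
    by rewrite xy arc_irrefl in yx.
  case/splitPr: xq qe qR qu qz le_n sub xh => q1 q2; rewrite cat_path last_cat.
  case: q1 => [|x1 q1] /=; first by rewrite eqxx.
  case/andP=> _ /andP [_ qe] qR qu qz le_n _ _.
  apply: (IHn (x :: q2)) => //=.
  - by rewrite yx.
  - by move=> v vq; apply: qR; rewrite -cat_cons inE mem_cat; move: vq;
    rewrite inE => /orP [->//|->]; rewrite !orbT.
  - suff: uniq (y :: x :: q2) by [].
    apply: (@subseq_uniq _ _ (y :: (x1 :: q1) ++ x :: q2)) => //.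
    by apply: (@cat_subseq _ [:: y] (x :: q2) [:: y] ((x1 :: q1) ++ x :: q2)) => //;
      apply: suffix_subseq.
  - by move: le_n; rewrite size_cat !ltnS; apply: leq_ltn_trans; apply: leq_addl.
have xz : x = z.
  by move: xo; rewrite (mem_outnbrs yR xR yx) orbF => /eqP.
have /subsetPn [s sR sy] : ~~ (R \subset [set y]).
  apply: contraTN y3 => /subsetP Ry; rewrite -ltnNge ltnS; apply: leq_trans min_card.
  apply/subset_leq_card/subsetP => v; rewrite inE => yv.
  apply: (mem_outnbrs yR _ yv); apply: contraTN yv => /Ry; rewrite inE => /eqP ->.
  by rewrite arc_irrefl.
exists [::], s; split=> //=; first by move=> v; rewrite inE => /eqP ->.
  by rewrite -xz.
by split=> //; move: sy; rewrite !inE.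
Qed.

(** The walk outside [R] is closed up by a path inside [R] from [y] back to [z] that misses some [s]
    in [R]. *)
Lemma cycle_through z p y : z \in outnbrs R -> path (avoid arc R) z p ->
  uniq (z :: p) -> arc (last z p) y -> y \in R ->
  exists C s, [/\ cycle arc C, uniq C, {subset z :: p <= C}, y \in C &
     s \in R /\ s \notin C].
Proof.
move=> zo; rewrite path_avoid => /andP [pe /hasPn pR] pu py yR.
have [zR _] := outnbrsP _ _ zo.
have [q [s [qe qu qR qz [sR sq]]]] := inside_path zo yR.
have zpR x : x \in z :: p -> x \notin R by rewrite inE => /orP [/eqP ->//|/pR].
exists ((z :: p) ++ (y :: q)), s; split.
- by rewrite /= rcons_cat cat_path pe /= py rcons_path qe.
- rewrite cat_uniq pu qu andbT; apply/hasPn => x /qR xR.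
  by apply: contraL xR; apply: zpR.
- by move=> x xp; rewrite mem_cat xp.
- by rewrite mem_cat mem_head orbT.
- split=> //; rewrite mem_cat negb_or sq andbT.
  by apply: contraL sR; apply: zpR.
Qed.

Variables z1 z2 : D.
Hypothesis oR : outnbrs R = [set z1; z2].

(* A set of at most two vertices separating s from C would, after replacing by
   z2 its vertex on the path from z2 to C if needed, contradict the minimality
   of R. *)
Lemma good_cycle C y s0 b : cycle arc C -> uniq C -> z1 \in C ->
  y \in R -> y \in C -> s0 \in R -> s0 \notin C ->
  b \in C -> connect (avoid arc (R :|: [set z1; z2])) z2 b -> top_minor F D.
Proof.
move=> cC uC z1C yR yC s0R s0C bC zb.
have [s [c [sR sC cC0 cs]]] : exists s c, [/\ s \in R, s \notin C, c \in C & arc c s].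
  (* The part of [R] on [C] is nonempty and proper, so by minimality it has an out-neighbour that is
     not one of [R]. This is the required [s]. *)
  have RC : #|outnbrs (R :&: [set x in C])| > 2.
    rewrite ltnNge; apply/negP => /(min_sub (subsetIl _ _)) E.
    have /E eqR : R :&: [set x in C] != set0 by apply/set0Pn; exists y; rewrite !inE yR.
    by move: s0R; rewrite -eqR !inE (negbTE s0C) andbF.
  have /subsetPn [s so sz] : ~~ (outnbrs (R :&: [set x in C]) \subset outnbrs R).
    by apply: contraTN RC => /subset_leq_card le; rewrite -leqNgt (leq_trans le min_card).
  have [sRC [c]] := outnbrsP _ _ so; rewrite !inE => /andP [cR cC0] cs.
  have sR : s \in R by apply: contraR sz => sR; apply: mem_outnbrs cR sR cs.
  by exists s, c; split=> //; move: sRC; rewrite !inE sR.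
apply: (fan_cycle_top_minor hF hsink cC uC sC cC0 cs) => X X3 sX.
case: (boolP [exists y in [set x in C], connect (avoid arc X) s y]).
  by case/existsP => v; rewrite inE => /andP [vC sv]; exists v.
rewrite negb_exists_in => /forall_inP noC.
have {noC} noC v : v \in reach X s -> v \notin C.
  by rewrite inE => sv; apply/negP => vC; have := noC v; rewrite inE sv => /(_ vC).
suff E : R :&: reach X s = R.
  by have := yR; rewrite -E inE => /andP [_ /noC]; rewrite yC.
apply: min_sub; first exact: subsetIl.
  by apply/set0Pn; exists s; rewrite inE sR reach_self.
(* An out-neighbour outside [X] is reached from [s], so it is neither in [R] nor equal to [z1],
   which lies on [C]; only [z2] remains. *)
have out v : v \in outnbrs (R :&: reach X s) ->
    v \in R :|: [set z1; z2] /\ (v \in X \/ v = z2 /\ z2 \in reach X s).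
  case/outnbrsP; rewrite inE => vRr [u]; rewrite inE => /andP [uR ur] uv.
  have vRo : v \in R :|: [set z1; z2].
    by rewrite inE; have [//|vR] := boolP (v \in R); rewrite -oR (mem_outnbrs uR vR uv).
  split=> //; have [vX|vX] := boolP (v \in X); [by left|right].
  have vr := reach_arc ur uv vX; rewrite vr andbT in vRr.
  move: vRo; rewrite inE in_set2 (negbTE vRr) orFb => /orP [/eqP vz|/eqP vz];
    last by rewrite -vz.
  by have := noC _ vr; rewrite vz z1C.
have [z2r|z2r] := boolP (z2 \in reach X s); last first.
  apply: leq_trans (_ : #|X| <= 2); last by [].
  by apply/subset_leq_card/subsetP => v /out [_ [//|[_]]]; rewrite (negbTE z2r).
(* If [z2] is reached, [X] must block its path to [b], so some [x] in [X] lies outside [R], [z1] and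
   [z2]. Exchanging [x] for [z2] keeps the bound two. *)
have /subsetPn [x xX xS] : ~~ (X \subset R :|: [set z1; z2]).
  apply/negP => sub; have /noC : b \in reach X s.
    rewrite inE; apply: connect_trans (sub_connect_avoid sub zb).
    by move: z2r; rewrite inE.
  by rewrite bC.
apply: leq_trans (_ : #|z2 |: (X :\ x)| <= 2).
  apply/subset_leq_card/subsetP => v /out [vS [vX|[-> _]]]; last by rewrite setU11.
  by rewrite !inE vX andbT; apply/orP; right; apply: contraNneq xS => <-.
rewrite cardsU1; move: X3; rewrite ltnS (cardsD1 x) xX.
by apply: leq_trans; rewrite leq_add2r leq_b1.
Qed.

End MinimalSet.

Lemma common_reach R z1 z2 w : minset (@small D) R -> r \notin R ->
  outnbrs R = [set z1; z2] -> w \notin R -> w \in reach R z1 -> w \in reach R z2 ->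
  top_minor F D.
Proof.
move=> Rmin rR oR wR z1w z2w.
have [l [y [lR wl ly yR]]] := enter (min_neq0 Rmin) wR.
have zl z : w \in reach R z -> exists p, [/\ path (avoid arc R) z p, last z p = l & uniq (z
  :: p)].
  by rewrite inE => zw; apply/connect_uniqP/(connect_trans zw).
have [p1 [p1e p1l p1u]] := zl _ z1w; have [p2 [p2e p2l p2u]] := zl _ z2w.
have zo1 : z1 \in outnbrs R by rewrite oR !inE eqxx.
have zo2 : z2 \in outnbrs R by rewrite oR !inE eqxx orbT.
(* If the path from [z2] passes through [z1], the cycle is built on it and [b] is [z2]. Otherwise
   the cycle is built on the path from [z1], and [z2] reaches [b], their common end [l], without
   meeting [z1]. *)
have [z1p2|z1p2] := boolP (z1 \in z2 :: p2).
  have [||C [s [cC uC subC yC [sR sC]]]] := cycle_through Rmin rR zo2 p2e p2u (y := y) => //.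
    by rewrite p2l.
  apply: (good_cycle Rmin oR cC uC (subC _ z1p2) yR yC sR sC (b := z2)) => //.
  by apply: subC; rewrite mem_head.
have [||C [s [cC uC subC yC [sR sC]]]] := cycle_through Rmin rR zo1 p1e p1u (y := y) => //.
  by rewrite p1l.
apply: (good_cycle Rmin oR cC uC _ yR yC sR sC (b := l)).
- by apply: subC; rewrite mem_head.
- by apply: subC; rewrite -p1l mem_last.
- apply/connectP; exists p2 => //; move: p2e; rewrite !path_avoid => /andP [-> /hasPn p2R].
  apply/hasPn => v vp; rewrite /= !inE !negb_or p2R //=; apply/andP; split.
    by apply: contraNneq z1p2 => <-; rewrite inE vp orbT.
  by apply: contraTneq p2u => <-; rewrite /= vp.
Qed.

(** [R] together with both reachable sets is closed under arcs, hence is everything by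
    strongness. *)
Lemma reach_cover R z1 z2 v : R != set0 -> outnbrs R = [set z1; z2] -> v \notin R ->
  v \in reach R z1 :|: reach R z2.
Proof.
move=> /set0Pn [x xR] oR vR.
suff : v \in R :|: (reach R z1 :|: reach R z2) by rewrite inE (negbTE vR).
apply: connect_closed (strong x v); last by rewrite inE xR.
move=> a b aT ab; rewrite inE; have [//|bR] := boolP (b \in R).
move: aT; rewrite 2!inE; case/or3P => [aR|aT|aT] /=.
- have := mem_outnbrs aR bR ab; rewrite oR in_set2 inE => /orP [] /eqP ->.
    by rewrite reach_self.
  by rewrite reach_self orbT.
- by rewrite inE (reach_arc aT ab bR).
- by rewrite inE (reach_arc aT ab bR) orbT.
Qed.

Lemma reach_disjoint R z1 z2 : minset (@small D) R -> r \notin R ->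
  outnbrs R = [set z1; z2] ->
  top_minor F D \/ (forall x, x \in reach R z1 -> x \notin reach R z2).
Proof.
move=> Rmin rR oR; have [/exists_inP [x x1 x2]|none] := boolP [exists x in reach R z1, x
  \in reach R z2].
  left; apply: (common_reach Rmin rR oR _ x1 x2).
  by apply: reach_notin x1; have /outnbrsP [] : z1 \in outnbrs R by rewrite oR set21.
by right; apply/forall_inP; rewrite -negb_exists_in.
Qed.

(* The part reachable from z1 outside R is replaced by arcs from z1 to the ends
   of the fan, the part reachable from z2 by a single arc; z2 becomes the
   exceptional vertex. *)
Lemma fan_reduction R z1 z2 a : R != set0 -> r \notin R ->
  outnbrs R = [set z1; z2] ->
  (forall x, x \in reach R z1 -> x \notin reach R z2) ->
  a \notin R :|: [set z1; z2] ->
  (forall X, #|X| < 3 -> z1 \notin X ->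
     exists2 y, y \in R & connect (avoid arc X) z1 y) ->
  top_minor F D.
Proof.
move=> R0 rR oR dis aS reachR.
have [z1R _] : z1 \notin R /\ exists2 x, x \in R & arc x z1.
  by apply/outnbrsP; rewrite oR set21.
have [z2R _] : z2 \notin R /\ exists2 x, x \in R & arc x z2.
  by apply/outnbrsP; rewrite oR set22.
have z12 : z1 != z2.
  by apply: contraNneq (dis z1 (reach_self _ _)) => ->; rewrite reach_self.
have [p [y [pP pdis]]] := fan z1R reachR.
have y_inj : injective y.
  by move=> i j yij; apply: (pdis i j (y i)); rewrite ?mem_rcons ?mem_head // yij mem_head.
have yR i : y i \in R by have [] := pP i.
have p1 i x : x \in p i -> x \in reach R z1.
  move=> xp; rewrite inE; apply: (path_connect (p := p i)); last by rewrite inE xp orbT.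
  have [pe _ _ pR] := pP i; rewrite path_avoid pR andbT.
  by move: pe; rewrite rcons_path => /andP [].
have [l [y2 [lR /connect_uniqP [p2 [p2e p2l p2u]] ly2 y2R]]] := enter R0 z2R.
have p2r x : x \in p2 -> x \in reach R z2.
  by move=> xp; rewrite inE; apply: (path_connect p2e); rewrite inE xp orbT.
have pS i x : x \in p i -> x \notin R :|: [set z1; z2].
  move=> xp; rewrite !inE !negb_or (reach_notin z1R (p1 _ _ xp)) /=; apply/andP; split.
    by apply: contraTneq xp => ->; have [_] := pP i;
      rewrite /= mem_rcons inE negb_or => /andP [/andP []].
  by apply: contraTneq (dis _ (p1 _ _ xp)) => ->; rewrite reach_self.
have p2S x : x \in p2 -> x \notin R :|: [set z1; z2].
  move=> xp; rewrite !inE !negb_or (reach_notin z2R (p2r _ xp)) /=; apply/andP; split.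
    by apply: contraTneq (p2r _ xp) => ->; apply/dis/reach_self.
  by apply: contraTneq p2u => <-; rewrite /= xp.
(* Recovers a fan path from its leaf; the default only concerns vertices that are not leaves. *)
pose ix v := odflt ord0 [pick i | y i == v].
have ixE i : ix (y i) = i.
  by rewrite /ix; case: pickP => [j /eqP /y_inj //|/(_ i)]; rewrite eqxx.
apply: (smaller_top_minor (S := R :|: [set z1; z2]) (w := z2) (a := a)
  (e := fun u v => if u == z1 then [exists i, y i == v] else
     if u == z2 then v == y2 else arc u v)
  (q := fun u v => if u == z1 then p (ix v) else if u == z2 then p2 else [::])) => //.
- by rewrite !inE eqxx !orbT.
- move=> u /=; case: eqP => [->|_].
    by apply/existsP => - [i /eqP E]; have := yR i; rewrite E (negbTE z1R).
  case: eqP => [->|_]; last exact: arc_irrefl.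
  by apply: contraNF z2R => /eqP ->.
- move=> u; rewrite inE in_set2 => uS uz2; rewrite (negbTE uz2) orbF in uS *.
  have [uz|uz] := eqVneq u z1.
    rewrite -[X in X <= _](card_ord 3) -(card_imset _ y_inj); apply: subset_leq_card.
    apply/subsetP => _ /imsetP [i _ ->]; rewrite !inE yR /=.
    by apply/existsP; exists i.
  rewrite (negbTE uz) orbF in uS; rewrite (card_out_in uS) ?oR //.
  by apply: hD; apply: contraNneq rR => <-.
- by exists y2; rewrite ?inE ?y2R // eq_sym (negbTE z12) !eqxx.
- move=> u v uS vS; have [->|uz1] := eqVneq u z1.
    case/existsP => i /eqP <-; rewrite ixE; have [pe pu _ _] := pP i.
    by split=> // x xp; apply: pS xp.
  have [->|uz2] := eqVneq u z2.
    move/eqP ->; rewrite rcons_path p2l ly2 andbT; split=> //.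
      by move: p2e; rewrite path_avoid => /andP [].
    rewrite -rcons_cons rcons_uniq p2u andbT inE negb_or (memPn z2R) //=.
    by apply: contraL y2R => /p2r; apply: reach_notin.
  move=> uv; rewrite /= uv inE !andbT; split=> //.
  by apply: contraTneq uv => ->; rewrite arc_irrefl.
- move=> u v u' v' x _ _ _ _.
  have [->|uz1] := eqVneq u z1; have [->|uz1'] := eqVneq u' z1.
  + case/existsP => i /eqP <- /existsP [j /eqP <-]; rewrite !ixE => xi xj.
    by rewrite (pdis i j x) // mem_rcons inE ?xi ?xj orbT.
  + case: (u' == z2) => // _ _ /p1 /dis + /p2r; by move/negbTE ->.
  + case: (u == z2) => // _ _ /p2r + /p1 /dis; by move->.
  + case: (eqVneq u z2) => // ->; case: (eqVneq u' z2) => // ->.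
    by move=> /eqP -> /eqP ->.
Qed.

Lemma second_cut R R2 z1 z2 y1 y2 : minset (@small D) R -> r \notin R ->
  outnbrs R = [set z1; z2] ->
  (forall x, x \in reach R z1 -> x \notin reach R z2) -> r \notin reach R z1 ->
  R2 != set0 -> R2 \subset reach R z1 -> outnbrs R2 = [set y1; y2] ->
  (forall x, x \in reach R2 y1 -> x \notin reach R2 y2) -> z2 \in reach R2 y2 ->
  top_minor F D.
Proof.
move=> Rmin rR oR dis rW R20 /subsetP R2W oR2 dis2 z2y2.
have z1R : z1 \notin R by have /outnbrsP [] : z1 \in outnbrs R by rewrite oR set21.
have z2o : z2 \in outnbrs R by rewrite oR set22.
have [z2R _] := outnbrsP _ _ z2o.
have z2R2 : z2 \notin R2 by apply/negP => /R2W /dis; rewrite reach_self.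
have y1R2 : y1 \notin R2 by have /outnbrsP [] : y1 \in outnbrs R2 by rewrite oR2 set21.
have RR2 x : x \in R -> x \notin R2.
  by move=> xR; apply: contraL xR => /R2W; apply: reach_notin.
(* Every vertex of [R] has a path inside [R] to [z2], which misses [R2]; reaching [R] from [y1]
   would therefore reach [z2]. *)
have R_y1 x : x \in R -> x \notin reach R2 y1.
  move=> xR; apply: contraL z2y2 => xy1; apply: dis2.
  have [q [_ [qe _ qR qz _]]] := inside_path Rmin rR z2o xR.
  move: xy1; rewrite !inE => xy1; apply: connect_trans xy1 _.
  apply/connectP; exists (rcons q z2); last by rewrite last_rcons.
  rewrite path_avoid rcons_path qe qz; apply/hasPn => v; rewrite mem_rcons inE.
  by case/orP => [/eqP -> //|vq]; apply: RR2; apply: qR; rewrite inE vq orbT.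
have z2_y1 x : x \in reach R z2 -> x \notin reach R2 y1.
  move=> xz2; apply: contraTN (reach_self R2 y1) => xy1.
  suff : x \in reach R2 y2 :&: reach R z2 by rewrite inE (negbTE (dis2 _ xy1)).
  move: xz2; rewrite inE; apply: connect_closed; last by rewrite inE z2y2 reach_self.
  move=> a b; rewrite !in_setI => /andP [ay2 az2] /andP [ab bR].
  have bz2 := reach_arc az2 ab bR; rewrite bz2 andbT.
  by apply: reach_arc ay2 ab _; apply/negP => /R2W /dis; rewrite bz2.
(* The enlarged set avoids [R] and everything reached from [z2], so by covering it stays on the side
   of [z1], away from [r]. *)
have QW x : x \in R2 :|: reach R2 y1 -> x \in reach R z1.
  rewrite inE => /orP [/R2W //|xy1].
  have xR : x \notin R by apply: contraL xy1; apply: R_y1.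
  have := reach_cover (min_neq0 Rmin) oR xR; rewrite inE => /orP [//|/z2_y1].
  by rewrite xy1.
have /set0Pn [u uR] := min_neq0 Rmin.
apply: (@one_cut (R2 :|: reach R2 y1) u z2).
- by have /set0Pn [x xR2] := R20; apply/set0Pn; exists x; rewrite inE xR2.
- by apply: contra rW; apply: QW.
- rewrite -(cards1 y2); apply/subset_leq_card/subsetP => v /outnbrsP [].
  rewrite in_setU negb_or => /andP [vR2 vy1] [x]; rewrite in_setU => /orP [xR2|xy1] xv.
    have := mem_outnbrs xR2 vR2 xv; rewrite oR2 in_set2 => /orP [/eqP vE|/eqP ->].
      by rewrite vE reach_self in vy1.
    by rewrite set11.
  by rewrite (reach_arc xy1 xv vR2) in vy1.
- by apply: contraNneq z2R => <-.
- by apply: contraL uR => /QW; apply: reach_notin.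
- by apply/negP => /QW /dis; rewrite reach_self.
Qed.

Lemma exception_on_one_side R z1 z2 a : minset (@small D) R -> r \notin R ->
  outnbrs R = [set z1; z2] ->
  (forall x, x \in reach R z1 -> x \notin reach R z2) -> r \notin reach R z1 ->
  a \notin R :|: [set z1; z2] -> top_minor F D.
Proof.
move=> Rmin rR oR dis rW aS.
have R0 := min_neq0 Rmin.
have z1R : z1 \notin R by have /outnbrsP [] : z1 \in outnbrs R by rewrite oR set21.
have z2R : z2 \notin R by have /outnbrsP [] : z2 \in outnbrs R by rewrite oR set22.
have [/forallP fanR|] := boolP [forall X : {set D}, (#|X| < 3) && (z1 \notin X) ==>
    [exists y in R, y \in reach X z1]].
  apply: (fan_reduction R0 rR oR dis aS) => X X3 z1X.
  have /existsP [y /andP [yR]] := implyP (fanR X) (introT andP (conj X3 z1X)).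
  by rewrite inE; exists y.
rewrite negb_forall => /existsP [X]; rewrite negb_imply negb_exists_in.
case/andP => /andP [X3 z1X] /forall_inP noR.
(* Since [X] cuts [z1] off from [R], walks from [z1] avoiding [X] never enter [R]. *)
have sub : reach X z1 \subset reach R z1.
  apply/subsetP => x; rewrite inE => z1x.
  suff : x \in reach X z1 :&: reach R z1 by rewrite inE => /andP [].
  apply: connect_closed z1x; last by rewrite inE !reach_self.
  move=> u v; rewrite !in_setI => /andP [uX uR] /andP [uv vX].
  have vr := reach_arc uX uv vX; rewrite vr (reach_arc uR uv) //.
  by apply: contraL vr; apply: noR.
have sX : small (reach X z1).
  rewrite /small; apply/andP; split; first by apply/set0Pn; exists z1; apply: reach_self.
  exact: leq_trans (subset_leq_card (outnbrs_reach X z1)) X3.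
have [R2 R2min R2X] := minset_exists sX.
have R2W := subset_trans R2X sub.
have rR2 : r \notin R2 by apply: contra rW; apply: (subsetP R2W).
have R20 := min_neq0 R2min.
have z2R2 : z2 \notin R2 by apply/negP => /(subsetP R2W) /dis; rewrite reach_self.
have /set0Pn [u uR] := R0.
have uR2 : u \notin R2 by apply: contraL uR => /(subsetP R2W); apply: reach_notin.
have [le1|gt1] := leqP #|outnbrs R2| 1.
  by apply: (one_cut R20 rR2 le1 _ uR2 z2R2); apply: contraNneq z2R => <-.
have /cards2P [y1 [y2 [_ oR2]]] : #|outnbrs R2| == 2.
  by rewrite eqn_leq gt1 (min_card R2min).
have [//|dis2] := reach_disjoint R2min rR2 oR2.
have := reach_cover R20 oR2 z2R2; rewrite inE => /orP [z2y|z2y].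
  apply: (second_cut Rmin rR oR dis rW R20 R2W _ _ z2y); first by rewrite oR2 setUC.
  by move=> x xy2; apply/negP => /dis2; rewrite xy2.
exact: (second_cut Rmin rR oR dis rW R20 R2W oR2 dis2 z2y).
Qed.

Lemma strong_case : top_minor F D.
Proof.
have /card_gt0P [v] := hr; rewrite inE => rv.
have vr : v != r by apply: contraTneq rv => ->; rewrite arc_irrefl.
(* Removing the out-neighbour [v] along with [r] guarantees two vertices outside [R] that end up on
   the same side. *)
have sV : small (~: [set r; v]).
  apply/andP; split.
    have /subsetPn [u uv ur] : ~~ ([set u | arc v u] \subset [set r; v]).
      apply: contraTN (hD vr) => /subset_leq_card; rewrite cards2 -ltnNge.
      by move/leq_ltn_trans; apply; rewrite eq_sym vr.
    by apply/set0Pn; exists u; rewrite inE.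
  apply: leq_trans (_ : #|[set r; v]| <= 2); last by rewrite cards2; case: (r != v).
  apply/subset_leq_card/subsetP => u /outnbrsP [].
  by rewrite inE negbK.
have [R Rmin RV] := minset_exists sV.
have R0 := min_neq0 Rmin.
have rR : r \notin R by apply/negP => /(subsetP RV); rewrite !inE eqxx.
have vR : v \notin R by apply/negP => /(subsetP RV); rewrite !inE eqxx orbT.
have [le1|gt1] := leqP #|outnbrs R| 1; first exact: (one_cut R0 rR le1 vr vR rR).
have /cards2P [z1 [z2 [_ oR]]] : #|outnbrs R| == 2.
  by rewrite eqn_leq gt1 (min_card Rmin).
have [//|dis] := reach_disjoint Rmin rR oR.
have side z z' : outnbrs R = [set z; z'] ->
    (forall x, x \in reach R z -> x \notin reach R z') -> r \in reach R z' -> top_minor F D.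
  move=> oRz disz rz'.
  have vz' : v \in reach R z' by apply: reach_arc rz' rv vR.
  have rz : r \notin reach R z by apply: contraL rz'; apply: disz.
  have nz x : x \in reach R z' -> x != z.
    by move=> xz'; apply: contraTneq xz' => ->; apply/disz/reach_self.
  (* Both [r] and [v] lie on the side of [z'], and at least one of them is not [z'] itself. *)
  have [a [aR az az']] : exists a, [/\ a \notin R, a != z & a != z'].
    have [E|ne] := eqVneq r z'; [exists v|exists r]; split=> //; try exact: nz.
    by rewrite -E.
  apply: (exception_on_one_side Rmin rR oRz disz rz (a := a)).
  by rewrite !inE !negb_or aR az.
have := reach_cover R0 oR rR; rewrite inE => /orP [rz1|rz2]; last exact: side dis rz2.
apply: (side z2 z1 _ _ rz1); first by rewrite oR setUC.
by move=> x xz2; apply/negP => /dis; rewrite xz2.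
Qed.

End Step.

Theorem one_exception_top_minor (F D : digraph) (r : D) :
  K4_orientation F -> (forall u : F, ~ sink u) ->
  0 < outdeg r -> (forall u : D, u != r -> 3 <= outdeg u) -> top_minor F D.
Proof.
move=> hF hsink; have [n] := ubnP #|D|; elim: n D r => // n IHn D r le_n hr hD.
have IH (D' : digraph) (r' : D') : #|D'| < #|D| -> 0 < outdeg r' ->
    (forall u : D', u != r' -> 3 <= outdeg u) -> top_minor F D'.
  by move=> lt; apply: IHn; apply: leq_trans lt le_n.
have [/forallP str|] := boolP [forall x : D, [forall y : D, connect (@arc D) x y]].
  by apply: (strong_case hF hsink hr hD IH) => x y; have /forallP := str x.
rewrite negb_forall => /existsP [x]; rewrite negb_forall => /existsP [y].
exact: (not_strong hr hD IH).
Qed.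

Theorem corollary1p19 (D : digraph) (hD : min_outdeg_geq D 3)
    (F : digraph) (hF : K4_orientation F) (hsink : forall u : F, ~ sink u) :
  contains_subdivision D F.
Proof.
apply: top_minor_contains; have /card_gt0P [r _] := vertex_gt0 D.
apply: (one_exception_top_minor hF hsink (r := r)) => [|u _]; last exact: hD.
exact: leq_trans (hD r).
Qed.
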